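(* Let $m\geq 3$, let $\epsilon\in\{+,-\}$ be either sign, and let $R,f_1,f_2>0$ be real constants. Let $M_R$ be the $m$-dimensional space-form of constant sectional curvature $\epsilon\, 1/R^2$, with metric $g$. Then one can always find a sufficiently small constant radius $s>0$ such that $(S_sM_R,g^{f_1,f_2})$ has positive scalar curvature, and a sufficiently large constant radius $s>0$ such that $(S_sM_R,g^{f_1,f_2})$ has negative scalar curvature.
   Context: $M_R$ denotes the sphere of radius $R$ in Euclidean space $\mathbb{R}^{m+1}$ (case $+$), or the hyperbolic space of constant sectional curvature $-1/R^2$ (case $-$). For a Riemannian manifold $(M,g)$, let $\pi:TM\to M$ be the tangent bundle, $V=\ker d\pi\cong\pi^*TM$, and let $H$ be the horizontal subbundle of the Levi-Civita connection, identified with $\pi^*TM$ through $d\pi$, so $TTM=H\oplus V$. The weighted metric on $TM$ is $g^{f_1,f_2}=f_1\pi^*g\oplus f_2\pi^*g$ with respect to $H\oplus V$. The tangent sphere bundle of radius $s$ is $S_sM=\{u\in TM: g(u,u)=s^2\}$, with the metric induced from $g^{f_1,f_2}$ as a submanifold of $TM$ (denoted by the same symbol). *)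

(* Defs.v *)
From HB Require Import structures.
From mathcomp Require Import all_boot all_order all_algebra.
From mathcomp Require Import all_classical all_reals all_analysis.

Set Implicit Arguments.
Unset Strict Implicit.
Unset Printing Implicit Defensive.

Import Order.TTheory GRing.Theory Num.Theory.
Import numFieldNormedType.Exports.

Local Open Scope classical_set_scope.
Local Open Scope ring_scope.

Section Coordinates.
Variable R : realType.

Definition partial n (i : 'I_n) (f : 'rV[R]_n -> R) (x : 'rV[R]_n) : R :=
  'D_('e_i) f x.

(* C^oo on U: a differentiable function is continuous, so asking that every
   iterated partial derivative be differentiable on the open set U is
   equivalent to asking that all of them exist and be continuous. *)
Definition smooth_on n p (U : set 'rV[R]_n) (F : 'rV[R]_n -> 'rV[R]_p) :=
  forall (j : 'I_p) (s : seq 'I_n) (x : 'rV[R]_n), U x ->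
    differentiable (foldr (@partial n) (fun y => F y 0 j) s) x.

(* Local parametrization of an n-dimensional submanifold N of R^p; the inverse
   of F is then a chart of N.  The dimension of N is not recorded: the
   definition is only used with n equal to the dimension of N. *)
Definition local_parametrization n p (U : set 'rV[R]_n)
    (F : 'rV[R]_n -> 'rV[R]_p) (N : set 'rV[R]_p) :=
  [/\ open U, smooth_on U F, set_inj U F, F @` U `<=` N
    & forall x, U x -> row_free ('J F x)].

Definition inner n (Q : 'M[R]_n) (u v : 'rV[R]_n) : R := (u *m Q *m v^T) 0 0.

(* F^*G, with 'J F x acting on row vectors: the differential is v *m 'J F x. *)
Definition pullback n p (F : 'rV[R]_n -> 'rV[R]_p) (G : 'rV[R]_p -> 'M[R]_p)
    (x : 'rV[R]_n) : 'M[R]_n :=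
  'J F x *m G (F x) *m ('J F x)^T.

Section Metric.
Variables (n : nat) (g : 'rV[R]_n -> 'M[R]_n).

(* Gamma^k_{ij} of the Levi-Civita connection *)
Definition christoffel (i j k : 'I_n) (x : 'rV[R]_n) : R :=
  2^-1 * \sum_l invmx (g x) k l *
    (partial i (fun y => g y j l) x + partial j (fun y => g y i l) x
     - partial l (fun y => g y i j) x).

(* R^l_{kij}, defined by R(d_i, d_j) d_k = sum_l R^l_{kij} d_l with
   R(X, Y) = [nabla_X, nabla_Y] - nabla_[X, Y] *)
Definition riemann (l k i j : 'I_n) (x : 'rV[R]_n) : R :=
  partial i (christoffel j k l) x - partial j (christoffel i k l) x
  + \sum_p (christoffel i p l x * christoffel j k p x
            - christoffel j p l x * christoffel i k p x).

(* Ric(d_j, d_k) is the trace of X |-> R(X, d_j) d_k, so that round spheres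
   have positive Ricci curvature. *)
Definition ricci (j k : 'I_n) (x : 'rV[R]_n) : R := \sum_i riemann i k i j x.

Definition scalar_curvature (x : 'rV[R]_n) : R :=
  \sum_j \sum_k invmx (g x) j k * ricci j k x.

(* Tangent bundle of a coordinate domain: the point row_mx x v of R^(n + n) is
   the tangent vector sum_i v_i d_i at x.  Tangent vectors to the tangent
   bundle are written row_mx a b in the same coordinates. *)

(* The differential of the bundle projection, row_mx a b |-> a; its kernel is
   the vertical bundle V. *)
Definition dproj : 'M[R]_(n + n, n) := col_mx 1%:M 0.

(* row_mx a b |-> b + (sum_ij Gamma^k_{ij} a_i v_j)_k: the projection onto the
   vertical bundle V (identified with the pull-back of the tangent bundle) along
   the horizontal bundle H of the Levi-Civita connection; H is its kernel. *)
Definition connector (z : 'rV[R]_(n + n)) : 'M[R]_(n + n, n) :=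
  col_mx (\matrix_(i, k) \sum_j christoffel i j k (lsubmx z) * rsubmx z 0 j)
         1%:M.

(* g^{f1,f2} = f1 pi^*g (+) f2 pi^*g with respect to H (+) V *)
Definition weighted_metric (f1 f2 : R) (z : 'rV[R]_(n + n)) : 'M[R]_(n + n) :=
  f1 *: (dproj *m g (lsubmx z) *m dproj^T)
  + f2 *: (connector z *m g (lsubmx z) *m (connector z)^T).

Definition tangent_sphere_over (U : set 'rV[R]_n) (s : R) : set 'rV[R]_(n + n) :=
  [set z | U (lsubmx z) /\ inner (g (lsubmx z)) (rsubmx z) (rsubmx z) = s ^+ 2].

End Metric.

(* kappa is the scalar curvature at z of the n-dimensional submanifold N of R^p
   with the metric induced by G, computed in local coordinates (W, F) around z;
   as a coordinate invariant, it does not depend on their choice. *)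
Definition induced_scalar_curvature n p (N : set 'rV[R]_p)
    (G : 'rV[R]_p -> 'M[R]_p) (z : 'rV[R]_p) (kappa : R) :=
  exists (W : set 'rV[R]_n) (F : 'rV[R]_n -> 'rV[R]_p) (y : 'rV[R]_n),
    [/\ local_parametrization W F N, W y, F y = z
      & scalar_curvature (pullback F G) y = kappa].

End Coordinates.

Variant geometry := Spherical | Hyperbolic.

Section SpaceForm.
Variables (R : realType) (m : nat) (e : geometry).

Definition geom_sign : R := if e is Spherical then 1 else -1.

(* The Euclidean form of R^(m+1) for Spherical, the Lorentzian form
   - x_0 y_0 + x_1 y_1 + ... + x_m y_m for Hyperbolic. *)
Definition ambient_form : 'M[R]_m.+1 :=
  diag_mx (\row_i (if i == ord0 then geom_sign else 1)).

(* The sphere of radius r, or the upper sheet of the hyperboloid <p, p> = - r^2,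
   whose induced metric has constant sectional curvature - 1 / r^2. *)
Definition space_form (r : R) : set 'rV[R]_m.+1 :=
  [set p | inner ambient_form p p = geom_sign * r ^+ 2
           /\ (e = Hyperbolic -> 0 < p 0 ord0)].

(* The vectors (p, u) of square norm s^2 of the tangent bundle; the tangent
   space at p is the orthogonal of p. *)
Definition tangent_sphere (r s : R) : set ('rV[R]_m.+1 * 'rV[R]_m.+1) :=
  [set z | [/\ space_form r z.1, inner ambient_form z.1 z.2 = 0
             & inner ambient_form z.2 z.2 = s ^+ 2]].

(* kappa is the scalar curvature at (p, u) of the tangent sphere bundle of
   radius s, of dimension 2m - 1, with the metric induced by g^{f1,f2}.  It is
   computed in the coordinates (x, v) of the tangent bundle given by a local
   parametrization psi of the space form, where p = psi x and u = d psi_x v. *)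
Definition tangent_sphere_scalar_curvature (r f1 f2 s : R)
    (z : 'rV[R]_m.+1 * 'rV[R]_m.+1) (kappa : R) :=
  exists (U : set 'rV[R]_m) (psi : 'rV[R]_m -> 'rV[R]_m.+1) (x v : 'rV[R]_m),
    let g := pullback psi (fun=> ambient_form) in
    [/\ local_parametrization U psi (space_form r), U x,
        psi x = z.1, v *m 'J psi x = z.2
      & @induced_scalar_curvature R (m + m.-1) _ (tangent_sphere_over g U s)
          (weighted_metric g f1 f2) (row_mx x v) kappa].

Definition positive_scalar_curvature (r f1 f2 s : R) :=
  forall z, tangent_sphere r s z ->
    exists2 kappa, tangent_sphere_scalar_curvature r f1 f2 s z kappa & 0 < kappa.

Definition negative_scalar_curvature (r f1 f2 s : R) :=
  forall z, tangent_sphere r s z ->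
    exists2 kappa, tangent_sphere_scalar_curvature r f1 f2 s z kappa & kappa < 0.

End SpaceForm.

(* Main.v *)
Require Import Defs.
From HB Require Import structures.
From mathcomp Require Import all_boot all_order all_algebra.
From mathcomp Require Import all_classical all_reals all_analysis.
From mathcomp Require Import ring lra.

Set Implicit Arguments.
Unset Strict Implicit.
Unset Printing Implicit Defensive.

Import Order.TTheory GRing.Theory Num.Theory.
Import numFieldNormedType.Exports.
Local Open Scope classical_set_scope.
Local Open Scope ring_scope.

(** The bundle projection is a Riemannian submersion of the tangent sphere bundle
    onto the space form with the metric f1 g, with totally geodesic fibres that are
    round spheres of squared radius K = f2 s^2.  Write m = n + 1 for the dimension
    of the base and c for its curvature.  O'Neill's formula says that the scalar
    curvature is that of the base, plus that of the fibre, minus the square norm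
    of the integrability tensor A_X Y = - R(X, Y) u / 2; as the curvature is
    constant this is
      n * ((n + 1) c / f1 + (n - 1) / K - K c^2 / (2 f1^2)).
    For n >= 2 the fibre term (n - 1) / K wins as s tends to 0, and the last term,
    which is negative as c is nonzero, wins as s tends to infinity.

    The value is obtained here by a direct computation in coordinates.  All points
    (p, u) of the bundle look alike: [adapted_frame] gives an isometry of the
    ambient form sending r e_0 to p and s e_1 to u, and composing stereographic
    coordinates with it gives a chart centred at p whose metric is rho^-2 times the
    Euclidean one ([pullback_space_form_chart], [christoffel_space_form_chart]).
    The vectors rho d_l then form an orthonormal frame, and
    (x, w) |-> (x, s rho(x) sigma(w)), where sigma parametrizes a hemisphere,
    is a local parametrization of the sphere bundle ([bundle_parametrization]).
    In it the weighted metric is explicit ([pullback_bundle_chart]):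
      f1 rho^-2 |dx|^2 + K |D|^2,
    where D is d sigma plus the connection form of the frame applied to sigma.

    At the centre this metric is diagonal, but its first derivatives do not
    vanish: their mixed part is the tensor A.  [scalar_curvatureE] expresses the
    scalar curvature at such a point by the second derivatives of the metric and
    squares of Christoffel symbols of the first kind, so that only the Taylor
    expansion of order 2 of the metric is needed; it is computed by an algebra of
    jets.  Summing the components R_ijji over horizontal, mixed and vertical
    planes gives [bundle_scalar_curvature]. *)

(** * Functions built from the coordinates *)

Section SmoothFunctions.
Context {R : realType} {n : nat}.
Implicit Types (U : set 'rV[R]_n) (f h : 'rV[R]_n -> R).

Lemma partial_eq_on U f h i x : open U -> (forall y, U y -> f y = h y) ->
  U x -> partial i f x = partial i h x.
Proof.
move=> oU fh Ux; apply: near_eq_derive.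
by apply: filterS (open_nbhs_nbhs (conj oU Ux)) => y /fh.
Qed.

(** Every function differentiated below is of this form.  The class is closed under
    partial derivatives, so that all regularity conditions reduce to exhibiting a
    formula; [smooth_ext] makes it depend on the values on U only. *)
Inductive smooth_fun U : ('rV[R]_n -> R) -> Prop :=
| smooth_cst a : smooth_fun U (fun=> a)
| smooth_coord i : smooth_fun U (fun x => x 0 i)
| smooth_add f h : smooth_fun U f -> smooth_fun U h ->
    smooth_fun U (fun x => f x + h x)
| smooth_mul f h : smooth_fun U f -> smooth_fun U h ->
    smooth_fun U (fun x => f x * h x)
| smooth_inv f : smooth_fun U f -> (forall x, U x -> f x != 0) ->
    smooth_fun U (fun x => (f x)^-1)
| smooth_sqrt f : smooth_fun U f -> (forall x, U x -> 0 < f x) ->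
    smooth_fun U (fun x => Num.sqrt (f x))
| smooth_ext f h : smooth_fun U f -> (forall x, U x -> f x = h x) ->
    smooth_fun U h.

Lemma differentiable_near_eq f h x : (\near x, f x = h x) ->
  differentiable f x -> differentiable h x.
Proof.
move=> fh /diff_locallyP[cdf /eqaddoP df].
have fhx : f x = h x := nbhs_singleton fh.
have fh0 : \forall v \near (0 : 'rV[R]_n), f (v + x) = h (v + x).
  move: fh; rewrite (near_shift 0)/=; apply: filterS => v /=.
  by rewrite subr0.
have dh : h \o shift x = cst (h x) + 'd f x +o_ 0 id.
  apply/eqaddoP => e e0; have {}df := df _ e0.
  apply: filterS2 fh0 df => v fhv; rewrite /= /shift/= => dv.
  rewrite -fhx -[X in `|X|]/(h (v + x) - (f x + 'd f x v)) -fhv; exact: dv.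
have dE := diff_unique cdf dh.
by apply/diff_locallyP; rewrite dE.
Qed.

Lemma smooth_sub U V f : V `<=` U -> smooth_fun U f -> smooth_fun V f.
Proof.
move=> VU; elim=> {f} [a|i|f h _ sf _ sh|f h _ sf _ sh|f _ sf f0|f _ sf f0
  |f h _ sf fh].
- exact: smooth_cst.
- exact: smooth_coord.
- exact: smooth_add.
- exact: smooth_mul.
- by apply: smooth_inv => // x /VU /f0.
- by apply: smooth_sqrt => // x /VU /f0.
- by apply: smooth_ext sf _ => x /VU /fh.
Qed.

Lemma smooth_fun_differentiable U f x : open U -> smooth_fun U f -> U x ->
  differentiable f x.
Proof.
move=> oU; elim=> {f} [a|i|f h _ df _ dh|f h _ df _ dh|f _ df f0|f _ df f0
  |f h _ df fh] Ux.
- exact: differentiable_cst.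
- exact: differentiable_coord.
- exact: differentiableD (df Ux) (dh Ux).
- exact: differentiableM (df Ux) (dh Ux).
- exact: differentiableV (df Ux) (f0 _ Ux).
- apply: (differentiable_comp (df Ux)); apply/derivable1_diffP.
  by have [] := is_derive1_sqrt (f0 _ Ux).
- apply: differentiable_near_eq (df Ux).
  by apply: filterS (open_nbhs_nbhs (conj oU Ux)) => y /fh.
Qed.

Lemma smooth_fun_derivable U f x v : open U -> smooth_fun U f -> U x ->
  derivable f x v.
Proof.
by move=> oU sf Ux; apply/diff_derivable/(smooth_fun_differentiable oU sf).
Qed.

Lemma smooth_fun_continuous U f x : open U -> smooth_fun U f -> U x ->
  {for x, continuous f}.
Proof.
move=> oU sf Ux; exact/differentiable_continuous/(smooth_fun_differentiable oU sf).
Qed.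

Lemma partial_cst a (i : 'I_n) (x : 'rV[R]_n) : partial i (fun=> a : R) x = 0.
Proof. exact: derive_cst. Qed.

Lemma partial_coord j i (x : 'rV[R]_n) :
  partial i (fun x : 'rV[R]_n => x 0 j) x = (i == j)%:R.
Proof.
have := derive_id x ('e_i); rewrite derive_mx; last exact: derivable_id.
by move=> /rowP/(_ j); rewrite !mxE eqxx/= eq_sym.
Qed.

Section PartialRules.
Variables (U : set 'rV[R]_n) (f h : 'rV[R]_n -> R) (i : 'I_n) (x : 'rV[R]_n).
Hypotheses (oU : open U) (sf : smooth_fun U f) (sh : smooth_fun U h) (Ux : U x).

Let df v : derivable f x v := @smooth_fun_derivable U f x v oU sf Ux.
Let dh v : derivable h x v := @smooth_fun_derivable U h x v oU sh Ux.

Lemma partialD : partial i (fun y => f y + h y) x = partial i f x + partial i h x.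
Proof. exact: (@deriveD _ _ _ f h x 'e_i (@df _) (@dh _)). Qed.

Lemma partialM : partial i (fun y => f y * h y) x
  = partial i f x * h x + f x * partial i h x.
Proof.
rewrite /partial (@deriveM _ _ f h x 'e_i (@df _) (@dh _)) addrC.
by congr (_ + _); exact: mulrC.
Qed.

Lemma partialV : f x != 0 ->
  partial i (fun y => (f y)^-1) x = - (f x)^-1 ^+ 2 * partial i f x.
Proof. by move=> f0; rewrite /partial (@deriveV _ _ f x 'e_i f0 (@df _)) exprVn. Qed.

Lemma partial_sqrt : 0 < f x ->
  partial i (fun y => Num.sqrt (f y)) x
  = 2^-1 * (Num.sqrt (f x))^-1 * partial i f x.
Proof.
move=> f0; have [ds dsE] := is_derive1_sqrt f0.
have dfx := smooth_fun_differentiable oU sf Ux.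
have dsx : differentiable Num.sqrt (f x) by exact/derivable1_diffP.
rewrite /partial deriveE; last exact: (differentiable_comp dfx dsx).
rewrite (diff_comp dfx dsx)/= -[X in 'd _ _ X = _]mulr1.
rewrite [LHS]linearZ/= -[X in _ *: X]deriveE// dsE invfM mulrC.
rewrite [RHS]mulrC deriveE//.
Qed.

End PartialRules.

Lemma smooth_opp U f : smooth_fun U f -> smooth_fun U (fun x => - f x).
Proof.
move=> sf; apply: (smooth_ext (f := fun x => -1 * f x)) => [|x _]; last by rewrite mulN1r.
exact: smooth_mul (smooth_cst _ _) sf.
Qed.

Lemma partialB U f h i x : open U -> smooth_fun U f -> smooth_fun U h -> U x ->
  partial i (fun y => f y - h y) x = partial i f x - partial i h x.
Proof.
move=> oU sf sh Ux.
exact: (@deriveB _ _ _ f h x 'e_i (smooth_fun_derivable oU sf Ux)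
  (smooth_fun_derivable oU sh Ux)).
Qed.

Lemma smooth_sum U (I : Type) (r : seq I) (F : I -> 'rV[R]_n -> R) :
  (forall k, smooth_fun U (F k)) -> smooth_fun U (fun x => \sum_(k <- r) F k x).
Proof.
move=> sF; elim: r => [|k r IH].
  by apply: (smooth_ext (f := fun=> 0)) => [|x _]; [exact: smooth_cst|rewrite big_nil].
apply: (smooth_ext (f := fun x => F k x + \sum_(k <- r) F k x)) => [|x _].
  exact: smooth_add.
by rewrite big_cons.
Qed.

Lemma smooth_prod U (I : Type) (r : seq I) (F : I -> 'rV[R]_n -> R) :
  (forall k, smooth_fun U (F k)) -> smooth_fun U (fun x => \prod_(k <- r) F k x).
Proof.
move=> sF; elim: r => [|k r IH].
  by apply: (smooth_ext (f := fun=> 1)) => [|x _]; [exact: smooth_cst|rewrite big_nil].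
apply: (smooth_ext (f := fun x => F k x * \prod_(k <- r) F k x)) => [|x _].
  exact: smooth_mul.
by rewrite big_cons.
Qed.

(** By induction, as each rule of differentiation yields a formula of the class. *)
Lemma smooth_partial U f i : open U -> smooth_fun U f -> smooth_fun U (partial i f).
Proof.
move=> oU; elim=> {f} [a|j|f h sf df sh dh|f h sf df sh dh|f sf df f0|f sf df f0
  |f h sf df fh].
- apply: (smooth_ext (f := fun=> 0)) => [|x _]; first exact: smooth_cst.
  by rewrite partial_cst.
- apply: (smooth_ext (f := fun=> (i == j)%:R)) => [|x _]; first exact: smooth_cst.
  by rewrite partial_coord.
- by apply: smooth_ext (smooth_add df dh) _ => x Ux; rewrite (partialD _ oU).
- apply: smooth_ext
    (smooth_add (smooth_mul df sh) (smooth_mul sf dh)) _.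
  by move=> x Ux; rewrite (partialM _ oU).
- have sVf := smooth_inv sf f0.
  apply: smooth_ext
    (smooth_mul (smooth_opp (smooth_mul sVf sVf)) df) _.
  by move=> x Ux; rewrite (partialV _ oU sf Ux (f0 _ Ux)) expr2.
- have sVf : smooth_fun U (fun x => (Num.sqrt (f x))^-1).
    apply: smooth_inv; first exact: smooth_sqrt.
    by move=> x /f0 fx; rewrite gt_eqF// sqrtr_gt0.
  apply: smooth_ext
    (smooth_mul (smooth_mul (smooth_cst _ 2^-1) sVf) df) _.
  by move=> x Ux; rewrite (partial_sqrt _ oU sf Ux (f0 _ Ux)).
- by apply: smooth_ext df _ => x Ux; exact: (partial_eq_on i oU fh Ux).
Qed.

Lemma smooth_det U k (M : 'rV[R]_n -> 'M[R]_k) :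
  (forall i j, smooth_fun U (fun x => M x i j)) -> smooth_fun U (fun x => \det (M x)).
Proof.
move=> sM; apply: smooth_sum => s; apply: smooth_mul; first exact: smooth_cst.
exact: smooth_prod.
Qed.

(** By Cramer's rule. *)
Lemma smooth_invmx U k (M : 'rV[R]_n -> 'M[R]_k) :
  (forall i j, smooth_fun U (fun x => M x i j)) ->
  (forall x, U x -> \det (M x) != 0) ->
  forall i j, smooth_fun U (fun x => invmx (M x) i j).
Proof.
move=> sM dM i j.
apply: (smooth_ext (f := fun x => (\det (M x))^-1 * cofactor (M x) j i)).
  apply: smooth_mul; first exact: smooth_inv (smooth_det sM) dM.
  apply: smooth_mul; first exact: smooth_cst.
  by apply: smooth_det => a b; apply: smooth_ext (sM (lift j a) (lift i b)) _ => x _;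
    rewrite !mxE.
by move=> x /dM dx; rewrite /invmx unitmxE unitfE dx !mxE.
Qed.

Lemma open_nonzero U f : open U -> smooth_fun U f -> open [set x | U x /\ f x != 0].
Proof.
move=> oU sf; rewrite openE => x [Ux fx].
have cf : \forall y \near x, f y != 0.
  exact: cvgr_neq0 (smooth_fun_continuous oU sf Ux) fx.
apply: filterS2 (open_nbhs_nbhs (conj oU Ux)) cf => y Uy fy; split=> //.
Qed.

Lemma open_positive U f : open U -> smooth_fun U f -> open [set x | U x /\ 0 < f x].
Proof.
move=> oU sf; rewrite openE => x [Ux fx].
have cf : \forall y \near x, 0 < f y.
  exact: (cvgr_gt _ (smooth_fun_continuous oU sf Ux)) fx.
apply: filterS2 (open_nbhs_nbhs (conj oU Ux)) cf => y Uy fy; split=> //.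
Qed.

Lemma smooth_map_differentiable U p (F : 'rV[R]_n -> 'rV[R]_p) x : open U ->
  (forall j, smooth_fun U (fun y => F y 0 j)) -> U x -> differentiable F x.
Proof.
move=> oU sF Ux.
have -> : F = \sum_j (fun y => F y 0 j *: ('e_j : 'rV[R]_p)).
  by apply/funext => y; rewrite fct_sumE -row_sum_delta.
apply: differentiable_sum => j; apply: differentiableZl.
exact: (smooth_fun_differentiable oU (sF j) Ux).
Qed.

Lemma jacobianE U p (F : 'rV[R]_n -> 'rV[R]_p) x i j : open U ->
  (forall j, smooth_fun U (fun y => F y 0 j)) -> U x ->
  'J F x i j = partial i (fun y => F y 0 j) x.
Proof.
move=> oU sF Ux; have dF := smooth_map_differentiable oU sF Ux.
rewrite mxE -deriveE// derive_mx ?mxE//.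
exact: diff_derivable.
Qed.

Lemma smooth_fun_smooth_on U p (F : 'rV[R]_n -> 'rV[R]_p) : open U ->
  (forall j, smooth_fun U (fun y => F y 0 j)) -> smooth_on U F.
Proof.
move=> oU sF j s x Ux; apply: (smooth_fun_differentiable oU _ Ux).
by elim: s => [|i s IH] /=; [exact: sF|exact: smooth_partial].
Qed.

End SmoothFunctions.

(** * Taylor expansions of order 2 *)

Section Jets.
Context {R : realType} {n : nat}.

Lemma partial_sum (U : set 'rV[R]_n) y (I : Type) (r : seq I) (F : I -> 'rV[R]_n -> R) i :
  open U -> U y -> (forall k, smooth_fun U (F k)) ->
  partial i (fun x => \sum_(k <- r) F k x) y = \sum_(k <- r) partial i (F k) y.
Proof.
move=> oU Uy sF; elim: r => [|k r IH].
  rewrite big_nil -[RHS](partial_cst 0 i y).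
  by apply: (partial_eq_on i oU _ Uy) => x _; rewrite big_nil.
rewrite big_cons -IH -(partialD i oU (sF k) (smooth_sum r sF) Uy).
by apply: (partial_eq_on i oU _ Uy) => x _; rewrite big_cons.
Qed.

Variables (U : set 'rV[R]_n) (y : 'rV[R]_n).
Hypotheses (oU : open U) (Uy : U y).
Implicit Types (f h : 'rV[R]_n -> R).

(** The value, gradient and Hessian at y are arguments, so that the rules below
    compute them from the shape of f, without an explicit formula for its
    derivatives away from y. *)
Record jet f (c : R) (L : 'I_n -> R) (Q : 'I_n -> 'I_n -> R) : Prop := Jet {
  jet_smooth : smooth_fun U f;
  jet_val : f y = c;
  jet_grad : forall i, partial i f y = L i;
  jet_hess : forall i j, partial i (partial j f) y = Q i j }.

Lemma jet_eq f c c' L L' Q Q' : jet f c L Q -> c = c' -> L =1 L' ->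
  (forall i j, Q i j = Q' i j) -> jet f c' L' Q'.
Proof.
by move=> [sf vf gf hf] <- LL QQ; split=> // *; rewrite ?gf ?hf ?LL ?QQ.
Qed.

Lemma jet_cst a : jet (fun=> a) a (fun=> 0) (fun=> fun=> 0).
Proof.
split=> // [|i|i j]; [exact: smooth_cst|exact: partial_cst|].
rewrite -[RHS](partial_cst 0 i y); apply: (partial_eq_on i oU _ Uy) => x _.
exact: partial_cst.
Qed.

Lemma jet_coord k : jet (fun x => x 0 k) (y 0 k) (fun i => (i == k)%:R)
  (fun=> fun=> 0).
Proof.
split=> // [|i|i j]; [exact: smooth_coord|exact: partial_coord|].
rewrite -[RHS](partial_cst (j == k)%:R i y).
by apply: (partial_eq_on i oU _ Uy) => x _; exact: partial_coord.
Qed.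

Lemma jetD f h c L Q c' L' Q' : jet f c L Q -> jet h c' L' Q' ->
  jet (fun x => f x + h x) (c + c') (fun i => L i + L' i)
    (fun i j => Q i j + Q' i j).
Proof.
move=> [sf vf gf hf] [sh vh gh hh]; split=> [||i|i j]; first exact: smooth_add.
- by rewrite vf vh.
- by rewrite (partialD _ oU)// gf gh.
- rewrite -hf -hh -(partialD _ oU)//; try exact: smooth_partial.
  by apply: (partial_eq_on i oU _ Uy) => x Ux; rewrite (partialD _ oU).
Qed.

Lemma jetM f h c L Q c' L' Q' : jet f c L Q -> jet h c' L' Q' ->
  jet (fun x => f x * h x) (c * c') (fun i => L i * c' + c * L' i)
    (fun i j => Q i j * c' + L i * L' j + L j * L' i + c * Q' i j).
Proof.
move=> [sf vf gf hf] [sh vh gh hh]; split=> [||i|i j]; first exact: smooth_mul.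
- by rewrite vf vh.
- by rewrite (partialM _ oU)// gf gh vf vh.
- rewrite (@partial_eq_on _ _ U _ (fun x => partial j f x * h x + f x * partial j h x))//.
    have sdf := smooth_partial j oU sf; have sdh := smooth_partial j oU sh.
    rewrite (partialD _ oU)//; [|exact: smooth_mul..].
    by rewrite !(partialM _ oU)// !gf !gh vf vh hf hh; ring.
  by move=> x Ux; rewrite (partialM _ oU).
Qed.

Lemma jet_sum (I : Type) (r : seq I) (F : I -> 'rV[R]_n -> R) c L Q :
  (forall k, jet (F k) (c k) (L k) (Q k)) ->
  jet (fun x => \sum_(k <- r) F k x) (\sum_(k <- r) c k)
    (fun i => \sum_(k <- r) L k i) (fun i j => \sum_(k <- r) Q k i j).
Proof.
move=> jF; split=> [||i|i j].
- by apply: smooth_sum => k; case: (jF k).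
- by apply: eq_bigr => k _; case: (jF k).
- rewrite (partial_sum _ _ oU)//; last by move=> k; case: (jF k).
  by apply: eq_bigr => k _; case: (jF k).
- rewrite (@partial_eq_on _ _ U _ (fun x => \sum_(k <- r) partial j (F k) x))//.
    rewrite (partial_sum _ _ oU)//; last by move=> k; apply: smooth_partial => //; case: (jF k).
    by apply: eq_bigr => k _; case: (jF k).
  by move=> x Ux; rewrite (partial_sum _ _ oU Ux)// => k; case: (jF k).
Qed.

(** Leaves the derivatives unevaluated: some factors only matter through their value
    and gradient, because what their Hessian gets multiplied by is 0. *)
Lemma smooth_jet f : smooth_fun U f ->
  jet f (f y) (fun i => partial i f y) (fun i j => partial i (partial j f) y).
Proof. by []. Qed.

(** At a critical point the Hessian of the inverse has no contribution from the
    gradient. *)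
Lemma jet_critical_inv f Q : jet f 1 (fun=> 0) Q -> (forall x, U x -> f x != 0) ->
  jet (fun x => (f x)^-1) 1 (fun=> 0) (fun i j => - Q i j).
Proof.
move=> [sf vf gf hf] f0; have sV := smooth_inv sf f0.
have g0 i : partial i (fun x => (f x)^-1) y = 0.
  by rewrite (partialV i oU sf Uy (f0 _ Uy)) gf mulr0.
split=> // [|i j]; first by rewrite vf invr1.
rewrite (@partial_eq_on _ _ U _
  (fun x => (-1 * (f x)^-1) * ((f x)^-1 * partial j f x)) i _ oU _ Uy); last first.
  by move=> x Ux; rewrite (partialV j oU sf Ux (f0 _ Ux)); ring.
have sm1 := smooth_cst U (-1).
have sdf := smooth_partial j oU sf.
have s1 := smooth_mul sm1 sV; have s2 := smooth_mul sV sdf.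
by rewrite !(partialM i oU)// partial_cst !g0 gf vf hf; field.
Qed.

End Jets.

(** * Scalar curvature at a point where the metric is diagonal *)

Lemma scalar_curvature_eq_on (R : realType) n (U : set 'rV[R]_n)
    (g h : 'rV[R]_n -> 'M[R]_n) x : open U -> (forall y, U y -> g y = h y) -> U x ->
  scalar_curvature g x = scalar_curvature h x.
Proof.
move=> oU gh Ux.
have chE i j k y : U y -> christoffel g i j k y = christoffel h i j k y.
  move=> Uy.
  have dE a b d : partial a (fun y => g y b d) y = partial a (fun y => h y b d) y.
    by apply: (partial_eq_on _ oU _ Uy) => z Uz; rewrite gh.
  rewrite /christoffel (gh y Uy); congr (2^-1 * _).
  by apply: eq_bigr => l _; rewrite !dE.
have dchE a i j k : partial a (christoffel g i j k) x = partial a (christoffel h i j k) x.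
  by apply: (partial_eq_on _ oU _ Ux) => z Uz; exact: chE.
rewrite /scalar_curvature (gh x Ux); apply: eq_bigr => j _; apply: eq_bigr => k _.
rewrite /ricci; congr (invmx (h x) j k * _); apply: eq_bigr => i _.
rewrite /riemann !dchE; congr (_ - _ + _).
by apply: eq_bigr => p _; rewrite !(chE _ _ _ _ Ux).
Qed.

Section ScalarCurvatureFormula.
Context {R : realType} {n : nat}.
Variables (U : set 'rV[R]_n) (g : 'rV[R]_n -> 'M[R]_n).
Hypotheses (oU : open U) (sg : forall i j, smooth_fun U (fun x => g x i j)).
Hypothesis dg : forall x, U x -> \det (g x) != 0.
Hypothesis symg : forall x i j, U x -> g x i j = g x j i.

(** Christoffel symbols of the first kind. *)
Definition christoffel1 i j k x : R :=
  2^-1 * (partial i (fun y => g y j k) x + partial j (fun y => g y i k) x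
          - partial k (fun y => g y i j) x).

Let sG i j k : smooth_fun U (christoffel1 i j k).
Proof.
apply: smooth_mul; first exact: smooth_cst.
by apply: smooth_add; [apply: smooth_add|apply: smooth_opp]; exact: smooth_partial.
Qed.

Let christoffelE i j k x :
  christoffel g i j k x = \sum_l invmx (g x) k l * christoffel1 i j l x.
Proof.
rewrite /christoffel mulr_sumr; apply: eq_bigr => l _.
by rewrite /christoffel1 mulrCA.
Qed.

Let sC i j k : smooth_fun U (christoffel g i j k).
Proof.
apply: (smooth_ext (f := fun x => \sum_l invmx (g x) k l * christoffel1 i j l x)).
  by apply: smooth_sum => l; apply: smooth_mul => //; exact: smooth_invmx.
by move=> x _; rewrite christoffelE.
Qed.

Let christoffel1E i j l x : U x ->
  \sum_k g x l k * christoffel g i j k x = christoffel1 i j l x.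
Proof.
move=> Ux; under eq_bigr do rewrite christoffelE mulr_sumr.
rewrite exchange_big/=.
have gV : g x *m invmx (g x) = 1%:M by rewrite mulmxV// unitmxE unitfE dg.
rewrite (bigD1 l)//= [X in _ + X]big1 ?addr0 => [|p pl].
  under eq_bigr do rewrite mulrA.
  rewrite -mulr_suml; have /matrixP/(_ l l) := gV.
  by rewrite !mxE eqxx => ->; rewrite mul1r.
under eq_bigr do rewrite mulrA.
rewrite -mulr_suml; have /matrixP/(_ l p) := gV.
by rewrite !mxE eq_sym (negPf pl) => ->; rewrite mul0r.
Qed.

Variables (y : 'rV[R]_n) (d : 'I_n -> R).
Hypotheses (Uy : U y) (d0 : forall i, d i != 0).
Hypothesis gy : forall i j, g y i j = (i == j)%:R * (d i)^-1.

Let gyV i j : invmx (g y) i j = (i == j)%:R * d i.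
Proof.
suff -> : invmx (g y) = diag_mx (\row_i d i) by rewrite !mxE; case: eqP => _;
  rewrite ?mul1r ?mul0r ?mulr1n ?mulr0n.
have gyE : g y = diag_mx (\row_i (d i)^-1).
  apply/matrixP => a b; rewrite gy !mxE.
  by case: eqP => _; rewrite ?mul1r ?mul0r ?mulr1n ?mulr0n.
have gM : g y *m diag_mx (\row_i d i) = 1%:M.
  rewrite gyE mulmx_diag -[RHS]diag_const_mx; congr diag_mx.
  by apply/rowP => k; rewrite !mxE mulVf.
have gu : g y \in unitmx by rewrite unitmxE unitfE dg.
by rewrite -[LHS]mulmx1 -gM mulKmx.
Qed.

Let christoffel_at i j k : christoffel g i j k y = d k * christoffel1 i j k y.
Proof.
rewrite christoffelE (bigD1 k)//= big1 ?addr0 => [|l lk].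
  by rewrite gyV eqxx mul1r.
by rewrite gyV eq_sym (negPf lk) !mul0r.
Qed.

Let dg1 a i j : partial a (fun x => g x i j) y
  = christoffel1 a i j y + christoffel1 a j i y.
Proof.
have E k l m : partial k (fun x => g x l m) y = partial k (fun x => g x m l) y.
  by apply: (partial_eq_on k oU _ Uy) => x Ux; rewrite symg.
by rewrite /christoffel1 (E i a j) (E j a i) (E a j i); field.
Qed.

Let christoffel1C i j k : christoffel1 i j k y = christoffel1 j i k y.
Proof.
have E k' l m : partial k' (fun x => g x l m) y = partial k' (fun x => g x m l) y.
  by apply: (partial_eq_on k' oU _ Uy) => x Ux; rewrite symg.
by rewrite /christoffel1 (E k i j); ring.
Qed.

(** Differentiating Gamma_ij,l = sum_k g_lk Gamma^k_ij, instead of the definition of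
    Gamma^l_ij, avoids the derivatives of the inverse matrix. *)
Let partial_christoffel a i j l : partial a (christoffel g i j l) y
  = d l * (partial a (christoffel1 i j l) y
    - \sum_k d k * (christoffel1 a l k y + christoffel1 a k l y) * christoffel1 i j k y).
Proof.
have -> : partial a (christoffel1 i j l) y
    = partial a (fun x => \sum_k g x l k * christoffel g i j k x) y.
  by apply: (partial_eq_on a oU _ Uy) => x Ux; rewrite christoffel1E.
rewrite (partial_sum _ _ oU Uy); last by move=> k; exact: smooth_mul.
under eq_bigr do rewrite (partialM _ oU)// dg1 christoffel_at gy.
rewrite big_split/=.
rewrite [X in _ + X - _](bigD1 l)//= [X in _ + (_ + X) - _]big1; last first.
  by move=> k kl; rewrite eq_sym (negPf kl) !mul0r.
rewrite eqxx mul1r addr0.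
have -> : \sum_k (christoffel1 a l k y + christoffel1 a k l y)
     * (d k * christoffel1 i j k y)
   = \sum_k d k * (christoffel1 a l k y + christoffel1 a k l y)
     * christoffel1 i j k y by apply: eq_bigr => k _; ring.
by rewrite addrAC subrr add0r mulVKf.
Qed.

Let partial_christoffel1 a i j l : partial a (christoffel1 i j l) y
  = 2^-1 * (partial a (partial i (fun x => g x j l)) y
     + partial a (partial j (fun x => g x i l)) y
     - partial a (partial l (fun x => g x i j)) y).
Proof.
have s2 k l' m := smooth_partial k oU (sg l' m).
rewrite /christoffel1 (partialM _ oU)//; first 1 last.
- exact: smooth_cst.
- by apply: smooth_add; [exact: smooth_add|exact: smooth_opp].
rewrite partial_cst mul0r add0r (partialB _ oU)//; last exact: smooth_add.
by rewrite (partialD _ oU).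
Qed.

(** The component R_ijji of the curvature tensor, if d is the diagonal of the inverse
    of g y. *)
Definition curvature_ijji i j : R :=
  partial i (partial j (fun x => g x i j)) y
  - 2^-1 * partial i (partial i (fun x => g x j j)) y
  - 2^-1 * partial j (partial j (fun x => g x i i)) y
  + \sum_k d k * (christoffel1 i j k y ^+ 2
                  - christoffel1 i i k y * christoffel1 j j k y).

(** A diagonal inverse metric contracts the curvature tensor to its components R_ijji.
    The products of Christoffel symbols in the Riemann tensor cancel half of those
    that come from the derivatives of the metric; the other half remains. *)
Lemma scalar_curvatureE :
  scalar_curvature g y = \sum_i \sum_j d i * d j * curvature_ijji i j.
Proof.
have -> : scalar_curvature g y = \sum_j \sum_i d j * riemann g i j i j y.
  apply: eq_bigr => j _; rewrite (bigD1 j)//= big1 ?addr0 => [|k kj].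
    by rewrite gyV eqxx mul1r /ricci mulr_sumr.
  by rewrite gyV eq_sym (negPf kj) !mul0r.
rewrite exchange_big/=; apply: eq_bigr => i _; apply: eq_bigr => j _.
rewrite /curvature_ijji /riemann !partial_christoffel !partial_christoffel1.
under [X in _ + X]eq_bigr do rewrite !christoffel_at.
have E k l a b : partial k (partial l (fun x => g x a b)) y
    = partial k (partial l (fun x => g x b a)) y.
  apply: (partial_eq_on k oU _ Uy) => x Ux.
  by apply: (partial_eq_on l oU _ Ux) => z Uz; rewrite symg.
rewrite (E i j j i) (E j i j i).
set S1 := \sum_k _; set S2 := \sum_k _; set S3 := \sum_k _; set S4 := \sum_k _.
(* S1 and S2 come from the derivatives of Christoffel symbols, S3 from their
   products in the Riemann tensor and S4 is the sum in R_ijji. *)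
suff -> : S3 = d i * (S4 + S1 - S2).
  clearbody S1 S2 S3 S4.
  move: (partial i _ _) (partial j (partial i _) _) (partial i (partial i _) _)
    (partial j (partial j _) _) => p1 p2 p3 p4.
  by field.
have -> : S4 + S1 - S2 = \sum_k
    (d k * (christoffel1 i j k y ^+ 2
            - christoffel1 i i k y * christoffel1 j j k y)
     + d k * (christoffel1 i i k y + christoffel1 i k i y) * christoffel1 j j k y
     - d k * (christoffel1 j i k y + christoffel1 j k i y) * christoffel1 i j k y).
  by rewrite sumrB big_split.
rewrite /S3 mulr_sumr; apply: eq_bigr => k _.
by rewrite (christoffel1C j i k); ring.
Qed.

End ScalarCurvatureFormula.

(** * Isometries of the ambient form *)

Lemma inner_delta (R : realType) n (M : 'M[R]_n) i j : inner M 'e_i 'e_j = M i j.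
Proof. by rewrite /inner -rowE trmx_delta -colE !mxE. Qed.

Section Reflection.
Context {R : realType} {n : nat}.
Variable Q : 'M[R]_n.
Hypothesis symQ : Q^T = Q.
Implicit Types (u v w a b : 'rV[R]_n) (A : 'M[R]_n).
Local Notation ip := (inner Q).

Lemma innerC u v : ip u v = ip v u.
Proof.
rewrite /inner -[in LHS](trmxK (u *m Q *m v^T)) mxE.
by rewrite trmx_mul trmxK trmx_mul symQ mulmxA.
Qed.

Lemma innerBl u v w : ip (u - v) w = ip u w - ip v w.
Proof. by rewrite /inner !mulmxBl !mxE. Qed.

Lemma innerZl c u v : ip (c *: u) v = c * ip u v.
Proof. by rewrite /inner -!scalemxAl mxE. Qed.

Lemma innerBr u v w : ip w (u - v) = ip w u - ip w v.
Proof. by rewrite ![ip w _]innerC innerBl. Qed.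

Lemma innerZr c u v : ip u (c *: v) = c * ip u v.
Proof. by rewrite ![ip u _]innerC innerZl. Qed.

Lemma inner_isometry A u v : A *m Q *m A^T = Q -> ip (u *m A) (v *m A) = ip u v.
Proof. by move=> AQ; rewrite /inner trmx_mul -{2}AQ !mulmxA. Qed.

Lemma isometryP A : (forall u v, ip (u *m A) (v *m A) = ip u v) ->
  A *m Q *m A^T = Q.
Proof.
move=> iA; apply/matrixP => i j.
by rewrite -!inner_delta -iA /inner trmx_mul !mulmxA.
Qed.

Definition reflection w : 'M[R]_n := 1%:M - (2 / ip w w) *: (Q *m w^T *m w).

Lemma mul_reflection u w : u *m reflection w = u - (2 * ip u w / ip w w) *: w.
Proof.
rewrite mulmxBr mulmx1 -scalemxAr !mulmxA [u *m Q *m w^T]mx11_scalar mul_scalar_mx.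
by rewrite scalerA mulrAC.
Qed.

Lemma reflection_isometry w : ip w w != 0 ->
  reflection w *m Q *m (reflection w)^T = Q.
Proof.
move=> w0; apply: isometryP => u v.
rewrite !mul_reflection innerBl !innerBr !innerZl !innerZr (innerC w v).
by field.
Qed.

(** The reflection along a - b; it fixes the orthogonal of a - b, which contains
    a + b as a and b have the same square norm. *)
Lemma isometry_swap a b : ip a a = ip b b -> ip (a - b) (a - b) != 0 ->
  exists2 A : 'M[R]_n, A *m Q *m A^T = Q &
    a *m A = b /\ forall u, ip u (a - b) = 0 -> u *m A = u.
Proof.
move=> ab w0; exists (reflection (a - b)); first exact: reflection_isometry.
split=> [|u u0]; rewrite mul_reflection; last by rewrite u0 mulr0 mul0r scale0r subr0.
suff -> : 2 * ip a (a - b) / ip (a - b) (a - b) = 1 by rewrite scale1r subKr.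
rewrite -[RHS](mulfV w0); congr (_ / _).
by rewrite innerBr innerBl !innerBr (innerC b a) ab; ring.
Qed.

End Reflection.

Section AmbientForm.
Context {R : realType} {n : nat} (e : geometry).
Local Notation Q := (ambient_form R n e).
Local Notation eps := (geom_sign R e).
Local Notation ip := (inner Q).
Implicit Types (u v w : 'rV[R]_n.+1) (A : 'M[R]_n.+1).

Lemma ambient_form_sym : Q^T = Q.
Proof. exact: tr_diag_mx. Qed.

Lemma ambient_innerE u v :
  ip u v = eps * u 0 ord0 * v 0 ord0 + \sum_(k < n) u 0 (lift ord0 k) * v 0 (lift ord0 k).
Proof.
rewrite /inner mul_mx_diag mxE big_ord_recl !mxE eqxx; congr (_ + _).
  by rewrite mulrC; ring.
by apply: eq_bigr => k _; rewrite !mxE/= mulr1.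
Qed.

Lemma geom_sign_sqr : eps * eps = 1.
Proof. by rewrite /geom_sign; case: e; ring. Qed.

Lemma ambient_formK : Q *m Q = 1%:M.
Proof.
rewrite /ambient_form mulmx_diag -diag_const_mx; congr diag_mx.
by apply/rowP => k; rewrite !mxE; case: eqP; rewrite ?mulr1 ?geom_sign_sqr.
Qed.

Lemma isometry_unitmx A : A *m Q *m A^T = Q -> A \in unitmx.
Proof.
move=> AQ; suff /mulmx1_unit[] : A *m (Q *m A^T *m Q) = 1%:M by [].
by rewrite !mulmxA AQ ambient_formK.
Qed.

Lemma ambient_inner_delta0 u : ip u 'e_ord0 = eps * u 0 ord0.
Proof.
rewrite ambient_innerE big1 ?addr0 => [|k _]; first by rewrite !mxE mulr1.
by rewrite !mxE /= mulr0.
Qed.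

(** The hypothesis always holds in the spherical case; in the hyperbolic one it says
    w_0 = 0, and the form is definite on that hyperplane. *)
Lemma ambient_inner_definite w : 0 <= eps * w 0 ord0 * w 0 ord0 ->
  ip w w = 0 -> w = 0.
Proof.
move=> w0 /eqP; rewrite ambient_innerE.
have sq k : 0 <= w 0 (lift ord0 k) * w 0 (lift ord0 k) by rewrite -expr2 sqr_ge0.
rewrite paddr_eq0//; last exact: sumr_ge0.
rewrite psumr_eq0// => /andP[/eqP w00 /allP wk].
apply/rowP => i; rewrite [RHS]mxE; case: (unliftP ord0 i) => [k ->|->].
  by have := wk k (mem_index_enum _); rewrite /= mulf_eq0 orbb => /eqP.
apply/eqP.
have : eps * (eps * w 0 ord0 * w 0 ord0) = 0 by rewrite w00 mulr0.
by rewrite !mulrA geom_sign_sqr mul1r => /eqP; rewrite mulf_eq0 orbb.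
Qed.

End AmbientForm.

Section AdaptedFrame.
Context {R : realType} {n : nat} (e : geometry).
Local Notation Q := (ambient_form R n.+1 e).
Local Notation eps := (geom_sign R e).
Local Notation ip := (inner Q).

(** A reflection, up to sign, sends e_0 to p / r.  Before it, a second reflection
    exchanges e_1 with the preimage of u / s; both are orthogonal to e_0, which is
    therefore fixed. *)
Lemma adapted_frame r s p u : 0 < r -> 0 < s ->
  tangent_sphere e r s (p, u) ->
  exists2 A : 'M[R]_n.+2, A *m Q *m A^T = Q &
    (r *: 'e_ord0) *m A = p /\ (s *: 'e_(lift ord0 ord0)) *m A = u.
Proof.
move=> r0 s0 [[/= pp p0] pu uu].
have symQ : Q^T = Q := ambient_form_sym e.
have e00 : ip 'e_ord0 'e_ord0 = eps by rewrite inner_delta !mxE eqxx mulr1n.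
have e11 : ip 'e_(lift ord0 ord0) 'e_(lift ord0 ord0) = 1.
  by rewrite inner_delta !mxE eqxx mulr1n.
have rn0 : r != 0 by rewrite gt_eqF.
have sn0 : s != 0 by rewrite gt_eqF.
have pp1 : ip (r^-1 *: p) (r^-1 *: p) = eps.
  by rewrite innerZl innerZr// pp; field.
have [A AQ Ap] : exists2 A : 'M[R]_n.+2, A *m Q *m A^T = Q & 'e_ord0 *m A = r^-1 *: p.
  have [eS|eH] : e = Spherical \/ e = Hyperbolic by case: (e); [left|right].
    have [->|pn] := eqVneq (r^-1 *: p) 'e_ord0.
      by exists 1%:M; rewrite ?mulmx1 ?mul1mx ?trmx1 ?mulmx1.
    have [||A AQ [Ap _]] := @isometry_swap _ _ Q symQ 'e_ord0 (r^-1 *: p).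
    - by rewrite e00 pp1.
    - apply: contraNneq pn => w0; rewrite eq_sym -subr_eq0; apply/eqP.
      apply: ambient_inner_definite w0.
      by rewrite {1}eS /= mul1r -expr2 sqr_ge0.
    by exists A.
  (* On the hyperboloid e_0 + p / r is timelike, hence not isotropic, so e_0 and
     - p / r are exchanged and the sign is corrected afterwards. *)
  have epsE : eps = -1 by rewrite /geom_sign eH.
  have [||A AQ [Ap _]] := @isometry_swap _ _ Q symQ 'e_ord0 (- r^-1 *: p).
  - by rewrite e00 innerZl innerZr// pp; field.
  - rewrite innerBl !innerBr// (innerC symQ _ (- r^-1 *: p)) e00.
    rewrite !innerZl innerZr// pp ambient_inner_delta0 epsE.
    have : 0 < r^-1 * p 0 ord0 by rewrite mulr_gt0 ?invr_gt0// p0.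
    have -> : - r^-1 * (- r^-1 * (-1 * r ^+ 2)) = -1 by field.
    by move=> ?; rewrite lt_eqF//; lra.
  exists (- A); first by rewrite linearN/= mulNmx mulNmx mulmxN opprK.
  by rewrite mulmxN Ap scaleNr opprK.
have Au := isometry_unitmx AQ.
pose u' := s^-1 *: (u *m invmx A).
have u'A : u' *m A = s^-1 *: u by rewrite -scalemxAl mulmxKV.
have u'0 : u' 0 ord0 = 0.
  have : ip u' 'e_ord0 = 0.
    rewrite -(inner_isometry u' _ AQ) u'A Ap innerZl innerZr// (innerC symQ) pu.
    by rewrite !mulr0.
  rewrite ambient_inner_delta0 => /(congr1 ( *%R eps)).
  by rewrite mulrA geom_sign_sqr mul1r mulr0.
have u'u' : ip u' u' = 1.
  rewrite -(inner_isometry u' _ AQ) u'A innerZl innerZr// uu.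
  by field.
have [B BQ [Bu Bp]] : exists2 B : 'M[R]_n.+2, B *m Q *m B^T = Q &
   'e_(lift ord0 ord0) *m B = u' /\ 'e_ord0 *m B = 'e_ord0 :> 'rV[R]_n.+2.
  have [->|un] := eqVneq u' 'e_(lift ord0 ord0).
    by exists 1%:M; rewrite ?mulmx1 ?mul1mx ?trmx1 ?mulmx1.
  have w0 : ('e_(lift ord0 ord0) - u') 0 ord0 = 0 by rewrite mxE [X in _ + X]mxE u'0 subr0 mxE.
  have [||B BQ [Bu Bp]] := @isometry_swap _ _ Q symQ 'e_(lift ord0 ord0) u'.
  - by rewrite e11 u'u'.
  - apply: contraNneq un => ww; rewrite eq_sym -subr_eq0; apply/eqP.
    by apply: ambient_inner_definite ww; rewrite w0 mulr0.
  exists B => //; split=> //; apply: Bp.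
  by rewrite (innerC symQ) ambient_inner_delta0 w0 mulr0.
exists (B *m A).
  by rewrite trmx_mul !mulmxA -(mulmxA B) -(mulmxA B) AQ.
by rewrite !mulmxA -!scalemxAl Bp Bu Ap u'A !scalerA !mulfV// !scale1r.
Qed.

End AdaptedFrame.

(** * Stereographic coordinates *)

Lemma sum_delta_l (R : pzRingType) n (i : 'I_n) (F : 'I_n -> R) :
  \sum_k (i == k)%:R * F k = F i.
Proof.
rewrite (bigD1 i)//= eqxx mul1r big1 ?addr0// => k ki.
by rewrite eq_sym (negPf ki) mul0r.
Qed.

Lemma sum_delta_r (R : pzRingType) n (i : 'I_n) (F : 'I_n -> R) :
  \sum_k F k * (i == k)%:R = F i.
Proof.
rewrite (bigD1 i)//= eqxx mulr1 big1 ?addr0// => k ki.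
by rewrite eq_sym (negPf ki) mulr0.
Qed.

Section ConformalFactor.
Context {R : realType} {n : nat} (c : R).

(** The Euclidean metric divided by the square of this function has curvature c. *)
Definition conformal_factor (x : 'rV[R]_n) : R :=
  1 + c / 4 * \sum_k x 0 k * x 0 k.
Local Notation rho := conformal_factor.

Lemma smooth_conformal_factor U : smooth_fun U rho.
Proof.
apply: smooth_add; first exact: smooth_cst.
apply: smooth_mul; first exact: smooth_cst.
by apply: smooth_sum => k; apply: smooth_mul; exact: smooth_coord.
Qed.

Lemma partial_conformal_factor i x : partial i rho x = c / 2 * x 0 i.
Proof.
have sT := smooth_cst [set: 'rV[R]_n].
have sq k := smooth_mul (smooth_coord [set: 'rV[R]_n] k) (smooth_coord _ k).
rewrite /conformal_factor (partialD i openT)//; last first.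
  by apply: smooth_mul => //; exact: smooth_sum.
rewrite (partialM i openT)//; last exact: smooth_sum.
rewrite !partial_cst mul0r !add0r (partial_sum _ _ openT)//.
under eq_bigr => k _.
  rewrite (partialM i openT)//; [|exact: smooth_coord..].
  rewrite partial_coord; over.
by rewrite /= big_split/= sum_delta_l sum_delta_r; field.
Qed.

End ConformalFactor.

Section StereographicChart.
Context {R : realType} {n : nat} (e : geometry) (r : R).
Hypothesis r0 : 0 < r.
Local Notation Q := (ambient_form R n e).
Local Notation eps := (geom_sign R e).
Local Notation c := (eps / r ^+ 2).

Local Notation rho := (conformal_factor c).

(** The inverse of the stereographic projection from - r e_0, scaled so that its
    differential at 0 is isometric. *)
Definition stereographic (x : 'rV[R]_n) : 'rV[R]_n.+1 :=
  \row_i if unlift ord0 i is Some k then x 0 k / rho x else r * (2 / rho x - 1).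
Local Notation psi0 := stereographic.

Lemma stereographic0 x : psi0 x 0 ord0 = r * (2 / rho x - 1).
Proof. by rewrite mxE unlift_none. Qed.

Lemma stereographicS x k : psi0 x 0 (lift ord0 k) = x 0 k / rho x.
Proof. by rewrite mxE liftK. Qed.

Lemma stereographic_norm x : 0 < rho x -> inner Q (psi0 x) (psi0 x) = eps * r ^+ 2.
Proof.
move=> rx; rewrite ambient_innerE stereographic0.
under eq_bigr do rewrite stereographicS mulrACA -invfM.
rewrite -mulr_suml.
have -> : \sum_k x 0 k * x 0 k = 4 * r ^+ 2 * eps * (rho x - 1).
  rewrite /conformal_factor addrAC subrr add0r.
  set S := \sum_k _.
  have -> : 4 * r ^+ 2 * eps * (c / 4 * S) = eps * eps * S.
    by field; rewrite gt_eqF.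
  by rewrite geom_sign_sqr mul1r.
by field; rewrite gt_eqF.
Qed.

Lemma stereographic_inj : {in [set x | 0 < rho x] &, injective psi0}.
Proof.
move=> x y; rewrite !inE/= => rx ry xy.
have rn0 : r != 0 by rewrite gt_eqF.
have rxn : rho x != 0 by rewrite gt_eqF.
have ryn : rho y != 0 by rewrite gt_eqF.
have rE : rho x = rho y.
  have : psi0 x 0 ord0 = psi0 y 0 ord0 by rewrite xy.
  rewrite !stereographic0 => /(mulfI rn0)/(addIr (-1)).
  by move=> H; apply: invr_inj; apply: (mulfI _ H).
apply/rowP => k; have : psi0 x 0 (lift ord0 k) = psi0 y 0 (lift ord0 k) by rewrite xy.
by rewrite !stereographicS rE => /(mulIf (invr_neq0 ryn)).
Qed.

Variables (U : set 'rV[R]_n) (A : 'M[R]_n.+1).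
Hypotheses (oU : open U) (Urho : forall x, U x -> 0 < rho x) (AQ : A *m Q *m A^T = Q).

Let rho0 x : U x -> rho x != 0. Proof. by move=> /Urho; exact: lt0r_neq0. Qed.

Lemma smooth_conformal_inv : smooth_fun U (fun x => (rho x)^-1).
Proof. exact: smooth_inv (smooth_conformal_factor _ _) rho0. Qed.
Let sV := smooth_conformal_inv.

Lemma smooth_stereographic j : smooth_fun U (fun x => psi0 x 0 j).
Proof.
case: (unliftP ord0 j) => [k ->|->].
  apply: (smooth_ext (f := fun x => x 0 k * (rho x)^-1)).
    exact: smooth_mul (smooth_coord _ _) sV.
  by move=> x _; rewrite stereographicS.
apply: (smooth_ext (f := fun x => r * (2 * (rho x)^-1 + -1))).
  apply: smooth_mul; first exact: smooth_cst.
  apply: smooth_add; last exact: smooth_cst.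
  exact: smooth_mul (smooth_cst _ _) sV.
by move=> x _; rewrite stereographic0.
Qed.

Let partial_rhoV i x : U x ->
  partial i (fun x => (rho x)^-1) x = - (c / 2) * x 0 i / rho x ^+ 2.
Proof.
move=> Ux; rewrite (partialV i oU)//; [|exact: smooth_conformal_factor|exact: rho0].
by rewrite partial_conformal_factor; field; rewrite rho0//= gt_eqF.
Qed.

Lemma partial_stereographic0 i x : U x ->
  partial i (fun x => psi0 x 0 ord0) x = - r * c * x 0 i / rho x ^+ 2.
Proof.
move=> Ux; under [X in partial _ X]eq_fun do rewrite stereographic0.
have s2 := smooth_mul (smooth_cst U 2) sV.
rewrite (partialM i oU)//; [|exact: smooth_cst|]; last first.
  by apply: smooth_add => //; exact: smooth_cst.
rewrite (partialB i oU)//; last exact: smooth_cst.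
rewrite (partialM i oU)//; last exact: smooth_cst.
rewrite !partial_cst partial_rhoV//; move: (rho0 Ux) => rx.
by move: (rho x) rx => t rx; move: c => c0; field.
Qed.

Lemma partial_stereographicS i k x : U x ->
  partial i (fun x => psi0 x 0 (lift ord0 k)) x
  = (i == k)%:R / rho x - c / 2 * x 0 i * x 0 k / rho x ^+ 2.
Proof.
move=> Ux; under [X in partial _ X]eq_fun do rewrite stereographicS.
rewrite (partialM i oU (smooth_coord _ _) sV)// partial_coord partial_rhoV//.
by move: (rho x) (rho0 Ux) => t rx; move: c => c0; field.
Qed.

Definition space_form_chart (x : 'rV[R]_n) := psi0 x *m A.
Local Notation psi := space_form_chart.

Lemma smooth_space_form_chart j : smooth_fun U (fun x => psi x 0 j).
Proof.
apply: (smooth_ext (f := fun x => \sum_k psi0 x 0 k * A k j)).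
  by apply: smooth_sum => k; exact: smooth_mul (smooth_stereographic _) (smooth_cst _ _).
by move=> x _; rewrite mxE.
Qed.

Lemma jacobian_space_form_chart x : U x -> 'J psi x = 'J psi0 x *m A.
Proof.
move=> Ux; apply/matrixP => i j.
rewrite (jacobianE i j oU smooth_space_form_chart Ux) [RHS]mxE.
rewrite -(partial_eq_on (f := fun x => \sum_k psi0 x 0 k * A k j) i oU _ Ux); last first.
  by move=> y _; rewrite mxE.
rewrite (partial_sum _ _ oU)//; last first.
  by move=> k; exact: smooth_mul (smooth_stereographic _) (smooth_cst _ _).
apply: eq_bigr => k _; rewrite (partialM i oU (smooth_stereographic k) (smooth_cst _ _))//.
by rewrite partial_cst mulr0 addr0 (jacobianE i k oU smooth_stereographic Ux).
Qed.

Lemma pullback_space_form_chart x : U x ->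
  pullback psi (fun=> Q) x = (rho x ^- 2)%:M.
Proof.
move=> Ux; rewrite /pullback jacobian_space_form_chart//.
rewrite trmx_mul !mulmxA -(mulmxA _ A) -(mulmxA _ (A *m Q)) AQ.
have J0 i : 'J psi0 x i ord0 = - r * c * x 0 i / rho x ^+ 2.
  by rewrite (jacobianE _ _ oU smooth_stereographic Ux) partial_stereographic0.
have JS i k : 'J psi0 x i (lift ord0 k)
    = (i == k)%:R / rho x - c / 2 * x 0 i * x 0 k / rho x ^+ 2.
  by rewrite (jacobianE _ _ oU smooth_stereographic Ux) partial_stereographicS.
move: ('J psi0 x) J0 JS => J J0 JS.
apply/matrixP => i j; rewrite /ambient_form mul_mx_diag mxE big_ord_recl !mxE eqxx !J0.
have rx := rho0 Ux.
(* These two relations are what makes the multiples of x_i x_j cancel. *)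
have cS : c * \sum_k x 0 k * x 0 k = 4 * (rho x - 1).
  by rewrite /conformal_factor addrAC subrr add0r; move: c => c0; field.
have rc : r * c * eps * (r * c) = c.
  transitivity (eps * eps * c); last by rewrite geom_sign_sqr mul1r.
  by field; rewrite gt_eqF.
move: (rho x) rx cS JS J0 => t rx cS JS J0.
move: c cS rc JS J0 => c0 cS rc JS J0.
rewrite (eq_bigr (fun k => (i == k)%:R * ((j == k)%:R / t ^+ 2
      - c0 / 2 * x 0 j * x 0 k / t ^+ 3)
    - (j == k)%:R * (c0 / 2 * x 0 i * x 0 k / t ^+ 3)
    + x 0 k * x 0 k * (c0 ^+ 2 / 4 * x 0 i * x 0 j / t ^+ 4))); last first.
  by move=> k _; rewrite !mxE/= mulr1 !JS; field.
rewrite big_split/= sumrB !sum_delta_l -mulr_suml -mulr_natl (eq_sym j i).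
transitivity ((r * c0 * eps * (r * c0)) * x 0 i * x 0 j / t ^+ 4
  + ((i == j)%:R / t ^+ 2 - c0 * x 0 i * x 0 j / t ^+ 3
    + (c0 * \sum_k x 0 k * x 0 k) * (c0 / 4 * x 0 i * x 0 j / t ^+ 4))).
  by field.
by rewrite rc cS; field.
Qed.

Lemma christoffel_space_form_chart i j k x : U x ->
  christoffel (pullback psi (fun=> Q)) i j k x
  = - (c / 2) / rho x * ((i == k)%:R * x 0 j + (j == k)%:R * x 0 i - (i == j)%:R * x 0 k).
Proof.
move=> Ux.
have dg l a b : partial l (fun x => pullback psi (fun=> Q) x a b) x
    = (a == b)%:R * (- c * x 0 l / rho x ^+ 3).
  rewrite (partial_eq_on (h := fun x => (a == b)%:R * ((rho x)^-1 * (rho x)^-1)) l oU _ Ux).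
    rewrite (partialM _ oU)//; [|exact: smooth_cst|exact: smooth_mul].
    rewrite partial_cst mul0r add0r (partialM _ oU)// partial_rhoV//.
    by field; rewrite rho0//= gt_eqF.
  move=> y Uy; rewrite pullback_space_form_chart// mxE [RHS]mulr_natl.
  by rewrite -expr2 exprVn.
rewrite /christoffel pullback_space_form_chart// invmx_scalar.
rewrite (eq_bigr (fun l => (k == l)%:R * (rho x ^+ 2 *
  ((j == l)%:R * (- c * x 0 i / rho x ^+ 3) + (i == l)%:R * (- c * x 0 j / rho x ^+ 3)
   - (i == j)%:R * (- c * x 0 l / rho x ^+ 3))))); last first.
  by move=> l _; rewrite !dg mxE invrK -[X in X * _ = _]mulr_natl; ring.
rewrite sum_delta_l; move: (rho x) (rho0 Ux) => t rx.
by move: c => c0; field.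
Qed.

End StereographicChart.

(** * The sphere bundle in conformally flat coordinates *)

Section ProductCoordinates.
Context {R : realType} {n1 n2 : nat}.

Lemma partial_lsubmx (f : 'rV[R]_n1 -> R) (i : 'I_(n1 + n2)) y :
  partial i (fun y : 'rV[R]_(n1 + n2) => f (lsubmx y)) y
  = 'D_(lsubmx ('e_i)) f (lsubmx y).
Proof.
rewrite /partial /derive; set L := fun h : R => _; set L' := fun h : R => _; suff -> : L = L' by [].
by apply/funext => h; rewrite /L /L' /= !linearD !linearZ.
Qed.

Lemma partial_rsubmx (f : 'rV[R]_n2 -> R) (i : 'I_(n1 + n2)) y :
  partial i (fun y : 'rV[R]_(n1 + n2) => f (rsubmx y)) y
  = 'D_(rsubmx ('e_i)) f (rsubmx y).
Proof.
rewrite /partial /derive; set L := fun h : R => _; set L' := fun h : R => _; suff -> : L = L' by [].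
by apply/funext => h; rewrite /L /L' /= !linearD !linearZ.
Qed.

Lemma lsubmx_delta_l a : lsubmx ('e_(lshift n2 a) : 'rV[R]_(n1 + n2)) = 'e_a.
Proof. by apply/rowP => k; rewrite !mxE/= eq_lshift. Qed.
Lemma lsubmx_delta_r a : lsubmx ('e_(rshift n1 a) : 'rV[R]_(n1 + n2)) = 0.
Proof. by apply/rowP => k; rewrite !mxE/= eq_lrshift. Qed.
Lemma rsubmx_delta_l a : rsubmx ('e_(lshift n2 a) : 'rV[R]_(n1 + n2)) = 0.
Proof. by apply/rowP => k; rewrite !mxE/= eq_rlshift. Qed.
Lemma rsubmx_delta_r a : rsubmx ('e_(rshift n1 a) : 'rV[R]_(n1 + n2)) = 'e_a.
Proof. by apply/rowP => k; rewrite !mxE/= eq_rshift. Qed.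

Lemma smooth_lsubmx (U : set 'rV[R]_n1) (V : set 'rV[R]_(n1 + n2)) f :
  (forall y, V y -> U (lsubmx y)) -> smooth_fun U f ->
  smooth_fun V (fun y => f (lsubmx y)).
Proof.
move=> VU; elim=> {f} [a|i|f h _ sf _ sh|f h _ sf _ sh|f _ sf f0|f _ sf f0
  |f h _ sf fh].
- exact: smooth_cst.
- by apply: smooth_ext (smooth_coord _ (lshift n2 i)) _ => x _; rewrite mxE.
- exact: smooth_add.
- exact: smooth_mul.
- by apply: smooth_inv => // y /VU /f0.
- by apply: smooth_sqrt => // y /VU /f0.
- by apply: smooth_ext sf _ => y /VU /fh.
Qed.

Lemma smooth_rsubmx (U : set 'rV[R]_n2) (V : set 'rV[R]_(n1 + n2)) f :
  (forall y, V y -> U (rsubmx y)) -> smooth_fun U f ->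
  smooth_fun V (fun y => f (rsubmx y)).
Proof.
move=> VU; elim=> {f} [a|i|f h _ sf _ sh|f h _ sf _ sh|f _ sf f0|f _ sf f0
  |f h _ sf fh].
- exact: smooth_cst.
- by apply: smooth_ext (smooth_coord _ (rshift n1 i)) _ => x _; rewrite mxE.
- exact: smooth_add.
- exact: smooth_mul.
- by apply: smooth_inv => // y /VU /f0.
- by apply: smooth_sqrt => // y /VU /f0.
- by apply: smooth_ext sf _ => y /VU /fh.
Qed.

End ProductCoordinates.

Section UnitSphere.
Context {R : realType} {n : nat}.
Implicit Types w : 'rV[R]_n.

Definition unit_ball : set 'rV[R]_n := [set w | 0 < 1 - \sum_k w 0 k * w 0 k].

(** All the components but the first are coordinates, so that only the first has
    derivatives of order 2. *)
Definition hemisphere w : 'rV[R]_n.+1 :=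
  \row_l if unlift ord0 l is Some k then w 0 k
         else Num.sqrt (1 - \sum_k w 0 k * w 0 k).
Local Notation sigma := hemisphere.

Lemma hemisphere0 w : sigma w 0 ord0 = Num.sqrt (1 - \sum_k w 0 k * w 0 k).
Proof. by rewrite mxE unlift_none. Qed.

Lemma hemisphereS w k : sigma w 0 (lift ord0 k) = w 0 k.
Proof. by rewrite mxE liftK. Qed.

Definition dhemisphere w (k : 'I_n) (l : 'I_n.+1) : R :=
  if unlift ord0 l is Some j then (k == j)%:R
  else - w 0 k / Num.sqrt (1 - \sum_k w 0 k * w 0 k).

Let sq U : smooth_fun U (fun w => \sum_k w 0 k * w 0 k).
Proof. by apply: smooth_sum => k; apply: smooth_mul; exact: smooth_coord. Qed.

Let sB U : smooth_fun U (fun w => 1 - \sum_k w 0 k * w 0 k).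
Proof. by apply: smooth_add; [exact: smooth_cst|exact: smooth_opp]. Qed.

Lemma open_unit_ball : open unit_ball.
Proof.
have -> : unit_ball = [set w | setT w /\ 0 < 1 - \sum_k w 0 k * w 0 k].
  by apply/seteqP; split=> w //= [].
exact: open_positive openT (sB _).
Qed.

Lemma hemisphere_norm w : unit_ball w -> \sum_l sigma w 0 l * sigma w 0 l = 1.
Proof.
move=> w1; rewrite big_ord_recl hemisphere0 -expr2 sqr_sqrtr ?ltW//.
by under [X in _ + X]eq_bigr do rewrite hemisphereS; rewrite subrK.
Qed.

Lemma smooth_hemisphere l : smooth_fun unit_ball (fun w => sigma w 0 l).
Proof.
case: (unliftP ord0 l) => [k ->|->].
  by apply: smooth_ext (smooth_coord _ k) _ => w _; rewrite hemisphereS.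
by apply: smooth_ext (smooth_sqrt (sB _) (fun _ => id)) _ => w _;
  rewrite hemisphere0.
Qed.

Lemma partial_hemisphere k l w : unit_ball w ->
  partial k (fun w => sigma w 0 l) w = dhemisphere w k l.
Proof.
move=> w1; rewrite /dhemisphere.
case: (unliftP ord0 l) => [j ->|->].
  under [X in partial _ X]eq_fun do rewrite hemisphereS.
  exact: partial_coord.
under [X in partial _ X]eq_fun do rewrite hemisphere0.
have t0 : Num.sqrt (1 - \sum_k w 0 k * w 0 k) != 0 by rewrite gt_eqF// sqrtr_gt0.
rewrite (partial_sqrt k open_unit_ball (sB _))//.
move: (Num.sqrt _) t0 => t t0.
rewrite (partialB k openT)//; [|exact: smooth_cst].
rewrite partial_cst (partial_sum _ _ openT)//; last first.
  by move=> ?; apply: smooth_mul; exact: smooth_coord.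
under eq_bigr => i _.
  rewrite (partialM k openT)//; [|exact: smooth_coord..].
  rewrite partial_coord; over.
rewrite /= big_split/= sum_delta_l sum_delta_r.
by field.
Qed.

Lemma smooth_dhemisphere k l : smooth_fun unit_ball (fun w => dhemisphere w k l).
Proof.
apply: smooth_ext (smooth_partial k open_unit_ball (smooth_hemisphere l)) _ => w.
exact: partial_hemisphere.
Qed.

End UnitSphere.

Lemma gram_mxE (R : comPzRingType) m n (f : 'I_m -> 'I_n -> R) i j :
  ((\matrix_(i, l) f i l) *m (\matrix_(i, l) f i l)^T) i j = \sum_l f i l * f j l.
Proof. by rewrite mxE; apply: eq_bigr => l _; rewrite !mxE. Qed.

Section SphereBundle.
Context {R : realType} {n : nat}.
Variables (c s f1 f2 : R) (U : set 'rV[R]_n.+1) (g : 'rV[R]_n.+1 -> 'M[R]_n.+1).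
Local Notation rho := (conformal_factor c).
Hypotheses (s0 : 0 < s) (oU : open U) (Urho : forall x, U x -> 0 < rho x).
Hypothesis gE : forall x, U x -> g x = (rho x ^- 2)%:M.
Hypothesis chrE : forall i j k x, U x -> christoffel g i j k x
  = - (c / 2) / rho x * ((i == k)%:R * x 0 j + (j == k)%:R * x 0 i - (i == j)%:R * x 0 k).
Local Notation N := (n.+1 + n)%N.
Implicit Type y : 'rV[R]_N.
Local Notation sigma := hemisphere.

Definition bundle_domain : set 'rV[R]_N :=
  [set y | U (lsubmx y) /\ unit_ball (rsubmx y)].

(** The vectors rho d_l form an orthonormal frame for the metric rho^-2 |dx|^2; the
    components of the tangent vector in that frame are s sigma. *)
Definition bundle_chart y : 'rV[R]_(n.+1 + n.+1) :=
  row_mx (lsubmx y) ((s * rho (lsubmx y)) *: sigma (rsubmx y)).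

(** Component l, in the orthonormal frame, of the covariant derivative of sigma along
    the coordinate i.  In the first case only the connection form of the frame
    contributes, in the second only d sigma. *)
Definition vertical_coframe (i : 'I_N) (l : 'I_n.+1) y : R :=
  match fintype.split i with
  | inl a => - (c / 2) / rho (lsubmx y) *
      ((\sum_b sigma (rsubmx y) 0 b * lsubmx y 0 b) * (a == l)%:R
       - sigma (rsubmx y) 0 a * lsubmx y 0 l)
  | inr k => dhemisphere (rsubmx y) k l
  end.

(** Component l of the projection to the base of the coordinate vector i. *)
Definition horizontal_coframe (i : 'I_N) (l : 'I_n.+1) : R :=
  match fintype.split i with inl a => (a == l)%:R | inr _ => 0 end.

Definition bundle_metric y : 'M[R]_N := \matrix_(i, j)
  (f1 * (rho (lsubmx y))^-1 ^+ 2 * (\sum_l horizontal_coframe i l * horizontal_coframe j l)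
   + f2 * s ^+ 2 * (\sum_l vertical_coframe i l y * vertical_coframe j l y)).

Lemma open_bundle_domain : open bundle_domain.
Proof.
have -> : bundle_domain = lsubmx @^-1` U `&` rsubmx @^-1` unit_ball by [].
apply: openI.
  by apply: open_comp => // y _; exact: continuous_lsubmx.
apply: open_comp; last exact: open_unit_ball.
by move=> y _; exact: continuous_rsubmx.
Qed.

Lemma smooth_vertical_coframe i l : smooth_fun bundle_domain (vertical_coframe i l).
Proof.
have Ul y : bundle_domain y -> U (lsubmx y) by case.
have Ur y : bundle_domain y -> unit_ball (rsubmx y) by case.
have ss a := smooth_rsubmx Ur (smooth_hemisphere a).
have sx a := smooth_lsubmx Ul (smooth_coord U a).
rewrite /vertical_coframe; case: (fintype.split i) => [a|k]; last first.
  exact: smooth_rsubmx Ur (smooth_dhemisphere k l).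
apply: smooth_mul.
  apply: smooth_mul; first exact: smooth_cst.
  apply: smooth_inv => [|y /Ul/Urho]; last exact: lt0r_neq0.
  exact: smooth_lsubmx Ul (smooth_conformal_factor _ _).
apply: smooth_add; last by apply: smooth_opp; exact: smooth_mul.
apply: smooth_mul; last exact: smooth_cst.
by apply: smooth_sum => b; exact: smooth_mul.
Qed.

Lemma smooth_bundle_metric i j : smooth_fun bundle_domain (fun y => bundle_metric y i j).
Proof.
have Ul y : bundle_domain y -> U (lsubmx y) by case.
apply: (smooth_ext (f := fun y =>
  f1 * ((rho (lsubmx y))^-1 * (rho (lsubmx y))^-1)
    * (\sum_l horizontal_coframe i l * horizontal_coframe j l)
   + f2 * s ^+ 2 * (\sum_l vertical_coframe i l y * vertical_coframe j l y))); last first.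
  by move=> y _; rewrite mxE expr2.
have sV : smooth_fun bundle_domain (fun y => (rho (lsubmx y))^-1).
  apply: smooth_inv => [|y /Ul/Urho]; last exact: lt0r_neq0.
  exact: smooth_lsubmx Ul (smooth_conformal_factor _ _).
apply: smooth_add.
  apply: smooth_mul; last exact: smooth_cst.
  by apply: smooth_mul; [exact: smooth_cst|exact: smooth_mul].
apply: smooth_mul; first exact: smooth_cst.
by apply: smooth_sum => l; apply: smooth_mul; exact: smooth_vertical_coframe.
Qed.

Lemma smooth_bundle_chart j : smooth_fun bundle_domain (fun y => bundle_chart y 0 j).
Proof.
have Ul y : bundle_domain y -> U (lsubmx y) by case.
have Ur y : bundle_domain y -> unit_ball (rsubmx y) by case.
case: (split_ordP j) => k ->.
  by apply: smooth_ext (smooth_lsubmx Ul (smooth_coord U k)) _ => y _;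
    rewrite row_mxEl.
apply: (smooth_ext (f := fun y => s * rho (lsubmx y) * sigma (rsubmx y) 0 k)).
  apply: smooth_mul; last exact: smooth_rsubmx Ur (smooth_hemisphere k).
  apply: smooth_mul; first exact: smooth_cst.
  exact: smooth_lsubmx Ul (smooth_conformal_factor _ _).
by move=> y _; rewrite row_mxEr [RHS]mxE.
Qed.

Let jacobian_l y i p : bundle_domain y ->
  'J bundle_chart y i (lshift n.+1 p) = horizontal_coframe i p.
Proof.
move=> By; rewrite (jacobianE _ _ open_bundle_domain smooth_bundle_chart)//.
under [X in partial _ X]eq_fun do rewrite row_mxEl.
rewrite (partial_lsubmx (fun x => x 0 p)) /horizontal_coframe.
case: split_ordP => a ->; first by rewrite lsubmx_delta_l; exact: partial_coord.
by rewrite lsubmx_delta_r derive0.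
Qed.

Let jacobian_r y i l : bundle_domain y ->
  'J bundle_chart y i (rshift n.+1 l) = match fintype.split i with
    | inl a => s * (c / 2 * lsubmx y 0 a) * sigma (rsubmx y) 0 l
    | inr k => s * rho (lsubmx y) * dhemisphere (rsubmx y) k l
    end.
Proof.
move=> By; rewrite (jacobianE _ _ open_bundle_domain smooth_bundle_chart)//.
have Ul y' : bundle_domain y' -> U (lsubmx y') by case.
have Ur y' : bundle_domain y' -> unit_ball (rsubmx y') by case.
have sr := smooth_lsubmx Ul (smooth_conformal_factor c U).
have ss := smooth_rsubmx Ur (smooth_hemisphere l).
rewrite (_ : (fun _ => _) = fun y => (s * rho (lsubmx y)) * sigma (rsubmx y) 0 l); last first.
  by apply/funext => z; rewrite row_mxEr [LHS]mxE.
have oB := open_bundle_domain.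
rewrite (partialM _ oB)//; last exact: smooth_mul (smooth_cst _ _) sr.
rewrite (partialM _ oB)//; last exact: smooth_cst.
rewrite partial_cst mul0r add0r partial_lsubmx (partial_rsubmx (fun w => sigma w 0 l)).
case: split_ordP => a ->.
  rewrite lsubmx_delta_l rsubmx_delta_l derive0 mulr0 addr0.
  by rewrite [X in s * X](partial_conformal_factor c a (lsubmx y)).
rewrite lsubmx_delta_r rsubmx_delta_r derive0 mulr0 mul0r add0r.
by rewrite [X in _ * X = _]partial_hemisphere//; exact: Ur.
Qed.

Let jacobian_dproj y : bundle_domain y ->
  'J bundle_chart y *m dproj R n.+1 = \matrix_(i, k) horizontal_coframe i k.
Proof.
move=> By; apply/matrixP => i k; rewrite [LHS]mxE [RHS]mxE big_split_ord/=.
rewrite [X in _ + X]big1 ?addr0 => [|p _]; last first.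
  by rewrite /dproj col_mxEd [X in _ * X]mxE mulr0.
rewrite (eq_bigr (fun p => horizontal_coframe i p * (k == p)%:R)); last first.
  by move=> p _; rewrite /dproj col_mxEu [X in _ * X = _]mxE eq_sym jacobian_l.
by rewrite sum_delta_r.
Qed.

(** The derivative of the factor rho cancels the terms x_a v_l in the contraction of
    the Christoffel symbols with v. *)
Let jacobian_connector y : bundle_domain y ->
  'J bundle_chart y *m connector g (bundle_chart y)
  = (s * rho (lsubmx y)) *: \matrix_(i, l) vertical_coframe i l y.
Proof.
move=> By; have [Uy wy] := By; have rn0 := lt0r_neq0 (Urho Uy).
apply/matrixP => i l; rewrite [LHS]mxE [RHS]mxE [X in _ = _ * X]mxE big_split_ord/=.
rewrite [X in _ + X](eq_bigr (fun p => 'J bundle_chart y i (rshift n.+1 p) * (l == p)%:R));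
  last by move=> p _; rewrite /connector col_mxEd [X in _ * X = _]mxE eq_sym.
rewrite sum_delta_r jacobian_r//.
rewrite (eq_bigr (fun p => horizontal_coframe i p *
    \sum_j christoffel g p j l (lsubmx y) * (s * rho (lsubmx y) * sigma (rsubmx y) 0 j)));
  last first.
  move=> p _; rewrite jacobian_l// /connector col_mxEu [X in _ * X = _]mxE.
  congr (_ * _); apply: eq_bigr => j _.
  by rewrite /bundle_chart row_mxKl row_mxKr [X in _ * X = _]mxE.
rewrite /horizontal_coframe /vertical_coframe.
case: (fintype.split i) => [a|k]; last by rewrite big1 ?add0r// => p _; rewrite mul0r.
rewrite sum_delta_l; move: (lsubmx y) (sigma (rsubmx y)) Uy rn0 => x v Ux rn0.
rewrite (eq_bigr (fun j => - (c / 2) * s * (a == l)%:R * (v 0 j * x 0 j)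
    - c / 2 * s * x 0 a * ((l == j)%:R * v 0 j)
    + c / 2 * s * x 0 l * ((a == j)%:R * v 0 j))); last first.
  by move=> j _; rewrite chrE// (eq_sym j l); field.
rewrite big_split/= sumrB -!mulr_sumr !sum_delta_l.
by field.
Qed.

Lemma pullback_bundle_chart y : bundle_domain y ->
  pullback bundle_chart (weighted_metric g f1 f2) y = bundle_metric y.
Proof.
move=> By; have [Uy wy] := By; have rn0 := lt0r_neq0 (Urho Uy).
rewrite /pullback /weighted_metric {2 4}/bundle_chart row_mxKl gE//.
have JJ (J : 'M[R]_(N, n.+1 + n.+1)) (M : 'M[R]_(n.+1 + n.+1, n.+1)) a :
    J *m (M *m a%:M *m M^T) *m J^T = a *: ((J *m M) *m (J *m M)^T).
  by rewrite trmx_mul !mulmxA mul_mx_scalar -!scalemxAl.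
rewrite mulmxDr mulmxDl -!scalemxAr -!scalemxAl !JJ jacobian_dproj// jacobian_connector//.
rewrite [X in _ + _ *: (_ *: (_ *m X))]linearZ/= -scalemxAr -scalemxAl !scalerA.
apply/matrixP => i j; rewrite [LHS]mxE [X in X + _ = _]mxE [X in _ + X = _]mxE !gram_mxE.
rewrite [RHS]mxE; congr (_ * _ + _ * _); first by rewrite exprVn.
by field.
Qed.

Lemma bundle_chart_inj : {in bundle_domain &, injective bundle_chart}.
Proof.
move=> y z; rewrite !inE => -[Uy wy] [Uz wz] /eq_row_mx[xE].
rewrite -xE => vE.
have sr : s * rho (lsubmx y) != 0 by rewrite mulf_neq0 ?lt0r_neq0// Urho.
have sE := scalerI sr vE.
rewrite -[y]hsubmxK -[z]hsubmxK xE; congr (row_mx _ _).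
by apply/rowP => k; rewrite -[LHS]hemisphereS sE hemisphereS.
Qed.

Lemma bundle_chart_sphere y : bundle_domain y ->
  tangent_sphere_over g U s (bundle_chart y).
Proof.
move=> [Uy wy]; rewrite /tangent_sphere_over /= /bundle_chart row_mxKl row_mxKr; split=> //.
have rn0 := lt0r_neq0 (Urho Uy).
rewrite /inner gE// mul_mx_scalar -scalemxAl mxE [X in _ * X]mxE.
rewrite (eq_bigr (fun l => (s * rho (lsubmx y)) ^+ 2 *
    (sigma (rsubmx y) 0 l * sigma (rsubmx y) 0 l))).
  by rewrite -mulr_sumr hemisphere_norm//; field.
move=> l _; rewrite [X in _ * X = _]mxE.
have -> : ((s * rho (lsubmx y)) *: sigma (rsubmx y)) 0 l
  = s * rho (lsubmx y) * sigma (rsubmx y) 0 l by rewrite [LHS]mxE.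
by ring.
Qed.

Lemma bundle_metric_sym y i j : bundle_metric y i j = bundle_metric y j i.
Proof.
by rewrite !mxE; congr (_ * _ + _ * _); apply: eq_bigr => l _; rewrite mulrC.
Qed.

(** Where the pulled-back metric is invertible the Jacobian of the parametrization has
    full rank. *)
Definition regular_bundle_domain : set 'rV[R]_N :=
  [set y | bundle_domain y /\ \det (bundle_metric y) != 0].

Lemma bundle_parametrization :
  local_parametrization regular_bundle_domain bundle_chart (tangent_sphere_over g U s).
Proof.
have WB : regular_bundle_domain `<=` bundle_domain by move=> y [].
split.
- exact: open_nonzero open_bundle_domain (smooth_det smooth_bundle_metric).
- move=> j t y /WB By.
  exact: (smooth_fun_smooth_on open_bundle_domain smooth_bundle_chart j t By).
- move=> y z; rewrite !inE => /WB By /WB Bz; apply: bundle_chart_inj; exact/mem_set.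
- by move=> _ [y /WB By <-]; exact: bundle_chart_sphere.
- move=> y [By dy]; apply/row_freeP.
  have pu : pullback bundle_chart (weighted_metric g f1 f2) y \in unitmx.
    by rewrite pullback_bundle_chart// unitmxE unitfE.
  exists (weighted_metric g f1 f2 (bundle_chart y) *m ('J bundle_chart y)^T
    *m invmx (pullback bundle_chart (weighted_metric g f1 f2) y)).
  by rewrite !mulmxA mulmxV.
Qed.

End SphereBundle.

(** * The bundle metric at the centre of the coordinates *)

Section BundleMetricJet.
Context {R : realType} {n : nat}.
Variables (c s f1 f2 : R) (U : set 'rV[R]_n.+1).
Local Notation rho := (conformal_factor c).
Hypotheses (oU : open U) (Urho : forall x, U x -> 0 < rho x) (U0 : U 0).
Local Notation N := (n.+1 + n)%N.
Implicit Type y : 'rV[R]_N.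
Local Notation sigma := hemisphere.
Local Notation B := (bundle_domain U : set 'rV[R]_N).
Local Notation K := (f2 * s ^+ 2).

Let unit_ball0 : unit_ball (0 : 'rV[R]_n).
Proof.
by rewrite /unit_ball /= big1 ?subr0// => k _; rewrite mxE mul0r.
Qed.

Let B0 : B 0.
Proof. by split; rewrite linear0. Qed.

Let oB : open B := open_bundle_domain oU.

Let Ul y : B y -> U (lsubmx y). Proof. by case. Qed.
Let Ur y : B y -> unit_ball (rsubmx y). Proof. by case. Qed.

(** The derivatives at 0, along the coordinate i, of x_k, w_k and sigma_l. *)
Let hx (i : 'I_N) (k : 'I_n.+1) : R := (i == lshift n k)%:R.
Let hw (i : 'I_N) (k : 'I_n) : R := (i == rshift n.+1 k)%:R.
Let hs (i : 'I_N) (l : 'I_n.+1) : R := if unlift ord0 l is Some k then hw i k else 0.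

Let jet_x k : jet B 0 (fun y => lsubmx y 0 k) 0 (hx ^~ k) (fun=> fun=> 0).
Proof.
rewrite (_ : (fun y => _) = fun y => y 0 (lshift n k)); last first.
  by apply/funext => y; rewrite mxE.
by apply: (jet_eq (jet_coord oB B0 (lshift n k))) => //; rewrite mxE.
Qed.

Let radicand0 : Num.sqrt (1 - \sum_k (0 : 'rV[R]_n) 0 k * (0 : 'rV[R]_n) 0 k) = 1.
Proof. by rewrite big1 ?subr0 ?sqrtr1// => k _; rewrite mxE mul0r. Qed.

(** The Hessian is left unspecified: sigma only occurs multiplied by components of x,
    which vanish at the centre. *)
Let jet_sigma l : exists Q,
  jet B 0 (fun y => sigma (rsubmx y) 0 l) (l == ord0)%:R (hs ^~ l) Q.
Proof.
have ss : smooth_fun B _ := smooth_rsubmx Ur (smooth_hemisphere l).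
eexists; apply: (jet_eq (smooth_jet 0 ss)) => //.
  rewrite linear0; case: (unliftP ord0 l) => [k ->|->].
    by rewrite hemisphereS mxE.
  by rewrite hemisphere0 radicand0 eqxx.
move=> i; rewrite (partial_rsubmx (fun w => sigma w 0 l)) linear0.
case: (split_ordP i) => a -> {i}.
  rewrite rsubmx_delta_l derive0 /hs; case: unlift => // k.
  by rewrite /hw eq_lrshift.
rewrite rsubmx_delta_r [LHS]partial_hemisphere// /dhemisphere /hs.
case: unlift => [k|]; last by rewrite mxE oppr0 mul0r.
by rewrite /hw eq_rshift.
Qed.

Let jet_rhoV : jet B 0 (fun y => (rho (lsubmx y))^-1) 1 (fun=> 0)
  (fun i j => - (c / 2 * \sum_k hx i k * hx j k)).
Proof.
apply: jet_critical_inv => // [|y /Ul/Urho]; last exact: lt0r_neq0.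
have j1 := jetD oB B0 (jet_cst oB B0 1) (jetM oB B0 (jet_cst oB B0 (c / 4))
  (jet_sum oB B0 (index_enum 'I_n.+1) (fun k => jetM oB B0 (jet_x k) (jet_x k)))).
apply: (jet_eq j1) => [|i|i j].
- by rewrite big1 ?mulr0 ?addr0// => k _; rewrite mulr0.
- rewrite mul0r !add0r big1 ?mulr0// => k _.
  by rewrite mulr0 mul0r addr0.
rewrite !mul0r !add0r.
rewrite (eq_bigr (fun k => 2 * (hx i k * hx j k))); first by rewrite -mulr_sumr; field.
by move=> k _; ring.
Qed.

Lemma horizontal_coframe_l a l : horizontal_coframe (lshift n a) l = (a == l)%:R :> R.
Proof. by rewrite /horizontal_coframe -[lshift n a]/(unsplit (inl a)) unsplitK. Qed.

Lemma horizontal_coframe_r k l : horizontal_coframe (rshift n.+1 k) l = 0 :> R.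
Proof. by rewrite /horizontal_coframe -[rshift _ k]/(unsplit (inr k)) unsplitK. Qed.

Lemma vertical_coframe_l a l y : vertical_coframe c (lshift n a) l y
  = - (c / 2) * (rho (lsubmx y))^-1 *
      ((\sum_b sigma (rsubmx y) 0 b * lsubmx y 0 b) * (a == l)%:R
       + -1 * (sigma (rsubmx y) 0 a * lsubmx y 0 l)).
Proof.
by rewrite /vertical_coframe -[lshift n a]/(unsplit (inl a)) unsplitK mulN1r.
Qed.

Lemma vertical_coframe_r k l y : vertical_coframe c (rshift n.+1 k) l y
  = dhemisphere (rsubmx y) k l.
Proof. by rewrite /vertical_coframe -[rshift _ k]/(unsplit (inr k)) unsplitK. Qed.

(** Gradient and Hessian at 0 of the vertical coframe along the directions of the
    base. *)
Let Lx (a l : 'I_n.+1) (i : 'I_N) : R :=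
  - (c / 2) * (hx i ord0 * (a == l)%:R - (a == ord0)%:R * hx i l).

Let Qx (a l : 'I_n.+1) (i j : 'I_N) : R := - (c / 2) *
  ((\sum_b (hs i b * hx j b + hs j b * hx i b)) * (a == l)%:R
   - (hs i a * hx j l + hs j a * hx i l)).

Let jet_vertical_l a l :
  jet B 0 (fun y => vertical_coframe c (lshift n a) l y) 0 (Lx a l) (Qx a l).
Proof.
under eq_fun do rewrite vertical_coframe_l.
have [Qs jsg] := choice jet_sigma.
have jS : jet B 0 (fun y => \sum_b sigma (rsubmx y) 0 b * lsubmx y 0 b) 0
    (hx ^~ ord0) (fun i j => \sum_b (hs i b * hx j b + hs j b * hx i b)).
  apply: (jet_eq (jet_sum oB B0 (index_enum 'I_n.+1)
    (fun b => jetM oB B0 (jsg b) (jet_x b)))) => [|i|i j].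
  - by rewrite big1// => k _; rewrite mulr0.
  - rewrite (eq_bigr (fun k => (ord0 == k)%:R * hx i k)) ?sum_delta_l// => k _.
    by rewrite mulr0 add0r eq_sym.
  - by apply: eq_bigr => k _; ring.
apply: (jet_eq (jetM oB B0 (jetM oB B0 (jet_cst oB B0 (- (c / 2))) jet_rhoV)
  (jetD oB B0 (jetM oB B0 jS (jet_cst oB B0 (a == l)%:R))
    (jetM oB B0 (jet_cst oB B0 (-1)) (jetM oB B0 (jsg a) (jet_x l))))))
  => [|i|i j]; rewrite ?/Lx ?/Qx; ring.
Qed.

Let Lw (k : 'I_n) (l : 'I_n.+1) (i : 'I_N) : R := - (hw i k * (l == ord0)%:R).

(** Only the component l = 0 has a nonzero Hessian; in the metric it gets multiplied by
    the values of components 0, which vanish at the centre. *)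
Let jet_vertical_r k l : exists q,
  jet B 0 (fun y => vertical_coframe c (rshift n.+1 k) l y) (lift ord0 k == l)%:R
    (Lw k l) (fun i j => (l == ord0)%:R * q i j).
Proof.
have -> : vertical_coframe c (rshift n.+1 k) l = fun y => dhemisphere (rsubmx y) k l.
  by apply/funext => y; rewrite vertical_coframe_r.
have ss : smooth_fun B _ := smooth_rsubmx Ur (smooth_dhemisphere k l).
have := smooth_jet 0 ss.
case: (unliftP ord0 l) => [j ->|->] j1.
  exists (fun=> fun=> 0); rewrite (_ : (fun y => _) = fun=> (k == j)%:R); last first.
    by apply/funext => y; rewrite /dhemisphere liftK.
  apply: (jet_eq (jet_cst oB B0 _)) => [|i|i i'].
  - by rewrite (inj_eq lift_inj).
  - by rewrite /Lw mulr0 oppr0.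
  - by rewrite mulr0.
eexists; apply: (jet_eq j1) => [|i|i i']; last by rewrite eqxx mul1r.
- by rewrite linear0 /dhemisphere unlift_none mxE oppr0 mul0r eq_sym.
rewrite (partial_rsubmx (fun w => dhemisphere w k ord0)) linear0 /Lw eqxx mulr1.
case: (split_ordP i) => b -> {i}; first by rewrite rsubmx_delta_l derive0 /hw eq_lrshift oppr0.
rewrite rsubmx_delta_r.
have sk : smooth_fun unit_ball (fun w : 'rV[R]_n => -1 * w 0 k).
  exact: smooth_mul (smooth_cst _ _) (smooth_coord _ _).
have sV : smooth_fun unit_ball (fun w : 'rV[R]_n => (sigma w 0 ord0)^-1).
  apply: smooth_inv; first exact: smooth_hemisphere.
  by move=> w w1; rewrite hemisphere0 gt_eqF// sqrtr_gt0.
rewrite -[LHS]/(partial b _ _).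
rewrite (partial_eq_on (h := fun w => (-1 * w 0 k) * (sigma w 0 ord0)^-1) b
  open_unit_ball _ unit_ball0); last first.
  by move=> w _; rewrite /dhemisphere unlift_none hemisphere0 mulN1r.
rewrite (partialM b open_unit_ball sk sV)// [X in _ * X * _]mxE mulr0 mul0r addr0.
rewrite (partialM b open_unit_ball)//; [|exact: smooth_cst|exact: smooth_coord].
rewrite partial_cst mul0r add0r partial_coord hemisphere0 radicand0 invr1 mulr1 mulN1r.
by rewrite /hw eq_rshift.
Qed.

Local Notation G := (@bundle_metric R n c s f1 f2).

Let jet_metric i j H vi vj Li Lj Qi Qj :
  (\sum_l horizontal_coframe i l * horizontal_coframe j l = H :> R) ->
  (forall l, jet B 0 (vertical_coframe c i l) (vi l) (Li l) (Qi l)) ->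
  (forall l, jet B 0 (vertical_coframe c j l) (vj l) (Lj l) (Qj l)) ->
  jet B 0 (fun y => G y i j) (f1 * H + K * \sum_l vi l * vj l)
    (fun p => K * \sum_l (Li l p * vj l + vi l * Lj l p))
    (fun p q => - (f1 * c * H * \sum_k hx p k * hx q k)
      + K * \sum_l (Qi l p q * vj l + Li l p * Lj l q + Li l q * Lj l p + vi l * Qj l p q)).
Proof.
move=> HE ji jj.
rewrite (_ : (fun y => _) = fun y => f1 * H * ((rho (lsubmx y))^-1 * (rho (lsubmx y))^-1)
    + K * (\sum_l vertical_coframe c i l y * vertical_coframe c j l y)); last first.
  by apply/funext => y; rewrite mxE HE; ring.
apply: (jet_eq (jetD oB B0
  (jetM oB B0 (jet_cst oB B0 (f1 * H)) (jetM oB B0 jet_rhoV jet_rhoV))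
  (jetM oB B0 (jet_cst oB B0 K)
    (jet_sum oB B0 (index_enum 'I_n.+1) (fun l => jetM oB B0 (ji l) (jj l))))))
  => [|p|p q].
- by ring.
- by ring.
- by field.
Qed.

Let jet_metric_ll a b : jet B 0 (fun y => G y (lshift n a) (lshift n b))
  (f1 * (a == b)%:R) (fun=> 0)
  (fun p q => - (f1 * c * (a == b)%:R * \sum_k hx p k * hx q k)
    + K * \sum_l (Lx a l p * Lx b l q + Lx a l q * Lx b l p)).
Proof.
have HE : \sum_l horizontal_coframe (lshift n a) l * horizontal_coframe (lshift n b) l
    = (a == b)%:R :> R.
  under eq_bigr do rewrite !horizontal_coframe_l.
  by rewrite sum_delta_l eq_sym.
apply: (jet_eq (jet_metric HE (jet_vertical_l a) (jet_vertical_l b))) => [|p|p q].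
- by rewrite big1 ?mulr0 ?addr0// => l _; rewrite mulr0.
- by rewrite big1 ?mulr0// => l _; rewrite mulr0 mul0r addr0.
- by congr (_ + _ * _); apply: eq_bigr => l _; ring.
Qed.

Let jet_metric_lr a k : jet B 0 (fun y => G y (lshift n a) (rshift n.+1 k))
  0 (fun p => K * Lx a (lift ord0 k) p)
  (fun p q => K * (Qx a (lift ord0 k) p q
     - (Lx a ord0 p * hw q k + Lx a ord0 q * hw p k))).
Proof.
have HE : \sum_l horizontal_coframe (lshift n a) l * horizontal_coframe (rshift n.+1 k) l
    = 0 :> R by rewrite big1// => l _; rewrite horizontal_coframe_r mulr0.
have [q jq] := choice (jet_vertical_r k).
apply: (jet_eq (jet_metric HE (jet_vertical_l a) jq)) => [|p|p r].
- by rewrite big1 ?mulr0 ?addr0// => l _; rewrite mul0r.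
- congr (_ * _); rewrite -[RHS](sum_delta_l (lift ord0 k) (fun l => Lx a l p)).
  by apply: eq_bigr => l _; ring.
rewrite mulr0 mul0r oppr0 add0r; congr (_ * _).
rewrite -[X in _ = X - _](sum_delta_l (lift ord0 k) (fun l => Qx a l p r)).
rewrite -[X in _ = _ - X](sum_delta_l ord0 (fun l => Lx a l p * hw r k + Lx a l r * hw p k)).
rewrite -sumrB; apply: eq_bigr => l _.
by rewrite /Lw (eq_sym ord0 l); ring.
Qed.

Let jet_metric_rr j k : jet B 0 (fun y => G y (rshift n.+1 j) (rshift n.+1 k))
  (K * (j == k)%:R) (fun p => 0)
  (fun p q => K * (hw p j * hw q k + hw q j * hw p k)).
Proof.
have HE : \sum_l horizontal_coframe (rshift n.+1 j) l * horizontal_coframe (rshift n.+1 k) l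
    = 0 :> R by rewrite big1// => l _; rewrite horizontal_coframe_r mul0r.
have [qj jj] := choice (jet_vertical_r j).
have [qk jk] := choice (jet_vertical_r k).
have l0 (x : 'I_n) l : (l == ord0)%:R * (lift ord0 x == l)%:R = 0 :> R.
  by case: eqP => [->|_]; rewrite ?mulr0 ?mul0r.
apply: (jet_eq (jet_metric HE jj jk)) => [|p|p r].
- by rewrite mulr0 add0r sum_delta_l eq_sym (inj_eq lift_inj).
- rewrite big1 ?mulr0// => l _; rewrite /Lw.
  transitivity (- (hw p j * ((l == ord0)%:R * (lift ord0 k == l)%:R)
    + hw p k * ((l == ord0)%:R * (lift ord0 j == l)%:R))); first by ring.
  by rewrite !l0; ring.
rewrite mulr0 mul0r oppr0 add0r; congr (_ * _).
rewrite -[RHS](sum_delta_l (ord0 : 'I_n.+1) (fun=> hw p j * hw r k + hw r j * hw p k)).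
apply: eq_bigr => l _; rewrite /Lw.
transitivity (qj l p r * ((l == ord0)%:R * (lift ord0 k == l)%:R)
  + qk l p r * ((l == ord0)%:R * (lift ord0 j == l)%:R)
  + ((l == ord0)%:R * (l == ord0)%:R) * (hw p j * hw r k + hw r j * hw p k)).
  by ring.
rewrite !l0 (eq_sym ord0 l); case: (l == ord0) => /=; ring.
Qed.

Hypotheses (s0 : 0 < s) (f10 : 0 < f1) (f20 : 0 < f2).

Let K0 : K != 0. Proof. by rewrite gt_eqF// mulr_gt0// exprn_gt0. Qed.
Let f1n0 : f1 != 0. Proof. exact: lt0r_neq0. Qed.

Let d (i : 'I_N) : R := match fintype.split i with inl _ => f1^-1 | inr _ => K^-1 end.

Let d_l a : d (lshift n a) = f1^-1.
Proof. by rewrite /d -[lshift n a]/(unsplit (inl a)) unsplitK. Qed.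
Let d_r k : d (rshift n.+1 k) = K^-1.
Proof. by rewrite /d -[rshift _ k]/(unsplit (inr k)) unsplitK. Qed.

Let bundle_metric0 i j : G 0 i j = (i == j)%:R * (d i)^-1.
Proof.
case: (split_ordP i) => a ->; case: (split_ordP j) => b ->.
- by rewrite (jet_val (jet_metric_ll a b)) eq_lshift d_l invrK mulrC.
- by rewrite (jet_val (jet_metric_lr a b)) eq_lrshift mul0r.
- by rewrite bundle_metric_sym (jet_val (jet_metric_lr b a)) eq_rlshift mul0r.
- by rewrite (jet_val (jet_metric_rr a b)) eq_rshift d_r invrK mulrC.
Qed.

Lemma regular_bundle_domain0 : regular_bundle_domain c s f1 f2 U 0.
Proof.
split=> //; have d0 i : d i != 0.
  by rewrite /d; case: fintype.split => _; rewrite invr_neq0.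
have -> : G 0 = diag_mx (\row_i (d i)^-1).
  apply/matrixP => i j; rewrite bundle_metric0 !mxE.
  by case: eqP => _; rewrite ?mul1r ?mul0r.
rewrite det_diag prodf_seq_neq0; apply/allP => i _ /=.
by rewrite mxE invr_neq0.
Qed.

Let G_sym i j : (fun y => G y i j) = fun y => G y j i.
Proof. by apply/funext => y; rewrite bundle_metric_sym. Qed.

Let grad_ll p a b : partial p (fun y => G y (lshift n a) (lshift n b)) 0 = 0.
Proof. exact: jet_grad (jet_metric_ll a b) p. Qed.
Let grad_lr p a k : partial p (fun y => G y (lshift n a) (rshift n.+1 k)) 0
  = K * Lx a (lift ord0 k) p.
Proof. exact: jet_grad (jet_metric_lr a k) p. Qed.
Let grad_rl p a k : partial p (fun y => G y (rshift n.+1 k) (lshift n a)) 0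
  = K * Lx a (lift ord0 k) p.
Proof.
by rewrite -grad_lr (G_sym (rshift n.+1 k) (lshift n a)).
Qed.
Let grad_rr p j k : partial p (fun y => G y (rshift n.+1 j) (rshift n.+1 k)) 0 = 0.
Proof. exact: jet_grad (jet_metric_rr j k) p. Qed.

Let hx_l a k : hx (lshift n a) k = (a == k)%:R.
Proof. by rewrite /hx eq_lshift. Qed.
Let hx_r j k : hx (rshift n.+1 j) k = 0.
Proof. by rewrite /hx eq_rlshift. Qed.
Let hw_l a k : hw (lshift n a) k = 0.
Proof. by rewrite /hw eq_lrshift. Qed.
Let hw_r j k : hw (rshift n.+1 j) k = (j == k)%:R.
Proof. by rewrite /hw eq_rshift. Qed.
Let Lx_l a l p : Lx a l (lshift n p)
  = - (c / 2) * ((p == ord0)%:R * (a == l)%:R - (a == ord0)%:R * (p == l)%:R).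
Proof. by rewrite /Lx !hx_l. Qed.
Let Lx_r a l j : Lx a l (rshift n.+1 j) = 0.
Proof. by rewrite /Lx !hx_r; ring. Qed.

Local Notation Gam := (christoffel1 G).

Let Gam_ll a b k : Gam (lshift n a) (lshift n b) k 0 = 0.
Proof.
rewrite /christoffel1; case: (split_ordP k) => p ->; first by rewrite !grad_ll; ring.
by rewrite !grad_lr grad_ll !Lx_l; ring.
Qed.
(** The tensor A: up to the symmetry of the symbols in the first two indices, no other
    one is nonzero at the centre. *)
Let Gam_lrl a k b : Gam (lshift n a) (rshift n.+1 k) (lshift n b) 0
  = - (K * c / 2) * ((a == ord0)%:R * (b == lift ord0 k)%:R
                   - (b == ord0)%:R * (a == lift ord0 k)%:R).
Proof.
by rewrite /christoffel1 grad_rl grad_ll grad_lr !Lx_l; field.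
Qed.
Let Gam_lrr a k j : Gam (lshift n a) (rshift n.+1 k) (rshift n.+1 j) 0 = 0.
Proof. by rewrite /christoffel1 grad_rr !grad_lr !Lx_r; ring. Qed.
Let Gam_rr j k p : Gam (rshift n.+1 j) (rshift n.+1 k) p 0 = 0.
Proof.
rewrite /christoffel1; case: (split_ordP p) => b ->; last by rewrite !grad_rr; ring.
by rewrite !grad_rl grad_rr !Lx_r; ring.
Qed.

Let GamC i j k : Gam i j k 0 = Gam j i k 0.
Proof.
by rewrite /christoffel1 (G_sym i j) [X in _ * (X - _) = _]addrC.
Qed.

Local Notation T := (curvature_ijji G 0 d).

Let sum_Lx a b p q : \sum_l Lx a l (lshift n p) * Lx b l (lshift n q)
  = c ^+ 2 / 4 * ((p == ord0)%:R * (q == ord0)%:R * (a == b)%:R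
      - (p == ord0)%:R * (b == ord0)%:R * (a == q)%:R
      - (a == ord0)%:R * (q == ord0)%:R * (p == b)%:R
      + (a == ord0)%:R * (b == ord0)%:R * (p == q)%:R).
Proof.
rewrite (eq_bigr (fun l =>
  (a == l)%:R * (c ^+ 2 / 4 * (p == ord0)%:R
     * ((q == ord0)%:R * (b == l)%:R - (b == ord0)%:R * (q == l)%:R))
  - (p == l)%:R * (c ^+ 2 / 4 * (a == ord0)%:R
     * ((q == ord0)%:R * (b == l)%:R - (b == ord0)%:R * (q == l)%:R)))); last first.
  by move=> l _; rewrite !Lx_l; field.
by rewrite sumrB !sum_delta_l (eq_sym b a) (eq_sym q a) (eq_sym b p) (eq_sym q p); ring.
Qed.

Let sum_hx p q : \sum_k hx (lshift n p) k * hx (lshift n q) k = (p == q)%:R.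
Proof. by under eq_bigr do rewrite !hx_l; rewrite sum_delta_l eq_sym. Qed.

Let hs_l a l : hs (lshift n a) l = 0.
Proof. by rewrite /hs; case: unlift => // k; rewrite hw_l. Qed.
Let hs_r k l : hs (rshift n.+1 k) l = (lift ord0 k == l)%:R.
Proof.
rewrite /hs; case: unliftP => [j ->|->//].
by rewrite hw_r (inj_eq lift_inj).
Qed.

Let Qx_lr a k : Qx a (lift ord0 k) (lshift n a) (rshift n.+1 k) = 0.
Proof.
rewrite /Qx !hx_r !hx_l hs_l hs_r.
rewrite (eq_bigr (fun b => (lift ord0 k == b)%:R * (a == b)%:R)); last first.
  by move=> b _; rewrite hx_r hx_l hs_l hs_r; ring.
by rewrite sum_delta_l (eq_sym _ a); case: (a == _) => /=; ring.
Qed.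

(** O'Neill's formula for a horizontal plane: the base term, minus three times the
    square norm of A_X Y, which is K c^2 / 4 when exactly one of a and b is the direction
    of u and 0 otherwise. *)
Let curvature_ll a b : T (lshift n a) (lshift n b)
  = f1 * c * (1 - (a == b)%:R) - 3 / 4 * K * c ^+ 2 *
    ((a == ord0)%:R + (b == ord0)%:R - 2 * (a == ord0)%:R * (b == ord0)%:R).
Proof.
rewrite /curvature_ijji big1 ?addr0; last by move=> k _; rewrite !Gam_ll; ring.
rewrite !(jet_hess (jet_metric_ll _ _)) !big_split/= !sum_Lx !sum_hx !eqxx.
case: (eqVneq a b) => [->|ab] /=; first by case: (b == ord0) => /=; field.
case: (eqVneq a ord0) ab => [->|_ _]; last by case: (b == ord0) => /=; field.
by rewrite eq_sym => /negPf ->; rewrite /=; field.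
Qed.

Let hess_rr_l a k : partial (lshift n a) (partial (lshift n a)
  (fun y => G y (rshift n.+1 k) (rshift n.+1 k))) 0 = 0.
Proof. by rewrite (jet_hess (jet_metric_rr _ _)) !hw_l; ring. Qed.

Let hess_ll_r a k : partial (rshift n.+1 k) (partial (rshift n.+1 k)
  (fun y => G y (lshift n a) (lshift n a))) 0 = 0.
Proof.
rewrite (jet_hess (jet_metric_ll _ _)) big1; last by move=> l _; rewrite hx_r mul0r.
by rewrite big1 ?mulr0 ?oppr0 ?addr0// => l _; rewrite !Lx_r mulr0 addr0.
Qed.

(** O'Neill's formula for a mixed plane: the square norm of A_X V.  It comes from the
    first derivatives of the metric alone. *)
Let curvature_lr a k : T (lshift n a) (rshift n.+1 k)
  = K ^+ 2 * c ^+ 2 / (4 * f1) * ((a == ord0)%:R + (a == lift ord0 k)%:R).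
Proof.
rewrite /curvature_ijji big_split_ord/= [X in _ + (_ + X)]big1 ?addr0; last first.
  by move=> j _; rewrite Gam_lrr Gam_ll; ring.
rewrite hess_rr_l hess_ll_r (jet_hess (jet_metric_lr _ _)) Qx_lr Lx_r Lx_l hw_l.
rewrite (eq_bigr (fun b => (lift ord0 k == b)%:R * (K ^+ 2 * c ^+ 2 / (4 * f1) * (a == ord0)%:R)
   + (ord0 == b)%:R * (K ^+ 2 * c ^+ 2 / (4 * f1) * (a == lift ord0 k)%:R))); last first.
  move=> b _; rewrite d_l Gam_lrl Gam_ll (eq_sym (lift _ _) b) (eq_sym ord0 b).
  case: (eqVneq a ord0) => [->|_] /=; last first.
    by case: (a == lift ord0 k); case: (b == ord0) => /=; field.
  by case: (b == lift ord0 k); case: (b == ord0) => /=; field.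
by rewrite big_split/= !sum_delta_l; ring.
Qed.

Let Qx_sym a l p q : Qx a l p q = Qx a l q p.
Proof.
rewrite /Qx [X in _ * (_ - X) = _]addrC.
by rewrite (eq_bigr (fun b => hs q b * hx p b + hs p b * hx q b)) // => b _; rewrite addrC.
Qed.

Let curvature_rl a k : T (rshift n.+1 k) (lshift n a) = T (lshift n a) (rshift n.+1 k).
Proof.
rewrite /curvature_ijji hess_rr_l hess_ll_r (G_sym (rshift n.+1 k) (lshift n a)).
rewrite !(jet_hess (jet_metric_lr _ _)).
rewrite (eq_bigr (fun p => d p * (Gam (lshift n a) (rshift n.+1 k) p 0 ^+ 2
  - Gam (lshift n a) (lshift n a) p 0 * Gam (rshift n.+1 k) (rshift n.+1 k) p 0))).
  by rewrite Qx_sym [X in K * (_ - X) - _ - _ + _ = _]addrC.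
by move=> p _; rewrite (GamC (rshift n.+1 k) (lshift n a)) [X in _ - X]mulrC.
Qed.

(** The curvature of the fibre, a round sphere of squared radius K. *)
Let curvature_rr j k : T (rshift n.+1 j) (rshift n.+1 k) = K * (1 - (j == k)%:R).
Proof.
rewrite /curvature_ijji big1 ?addr0; last by move=> p _; rewrite !Gam_rr; ring.
rewrite !(jet_hess (jet_metric_rr _ _)) !hw_r !eqxx (eq_sym k j).
by case: (j == k) => /=; field.
Qed.

Let sum_cst p (x : R) : \sum_(i < p) x = p%:R * x.
Proof. by rewrite sumr_const card_ord mulr_natl. Qed.

Lemma bundle_scalar_curvature : scalar_curvature G 0
  = n%:R * (n.+1%:R * c / f1 + (n%:R - 1) / (f2 * s ^+ 2)
            - f2 * s ^+ 2 * c ^+ 2 / (2 * f1 ^+ 2)).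
Proof.
pose W : set 'rV[R]_N := regular_bundle_domain c s f1 f2 U.
have WB : W `<=` B by move=> y [].
have sG i j : smooth_fun B (fun y => G y i j) by exact: smooth_bundle_metric.
have oW : open W by apply: open_nonzero => //; exact: smooth_det.
have d0 i : d i != 0.
  by rewrite /d; case: fintype.split => _; rewrite invr_neq0.
have detW y : W y -> \det (G y) != 0 by case.
rewrite (scalar_curvatureE oW (fun i j => smooth_sub WB (sG i j)) detW
  (fun y i j _ => bundle_metric_sym c s f1 f2 y i j)
  regular_bundle_domain0 d0 bundle_metric0).
rewrite big_split_ord/=.
have sum_ll a : \sum_b d (lshift n a) * d (lshift n b) * T (lshift n a) (lshift n b)
    = f1^-1 ^+ 2 * (n%:R * f1 * c - 3 / 4 * K * c ^+ 2)
      + (ord0 == a)%:R * (f1^-1 ^+ 2 * (- (3 / 4 * K * c ^+ 2) * (n%:R - 1))).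
  rewrite (eq_bigr (fun b => f1^-1 ^+ 2 * (f1 * c - 3 / 4 * K * c ^+ 2 * (a == ord0)%:R)
      + ((a == b)%:R * (- (f1^-1 ^+ 2 * f1 * c))
      + (ord0 == b)%:R * (f1^-1 ^+ 2 * (- (3 / 4 * K * c ^+ 2) * (1 - 2 * (a == ord0)%:R)))))).
    rewrite !big_split/= !sum_delta_l sum_cst (eq_sym a) -natr1.
    by case: (ord0 == a) => /=; ring.
  by move=> b _; rewrite !d_l curvature_ll (eq_sym b); ring.
have sum_lr k : \sum_a d (lshift n a) * d (rshift n.+1 k) * T (lshift n a) (rshift n.+1 k)
    = K * c ^+ 2 / (2 * f1 ^+ 2).
  rewrite (eq_bigr (fun a => (ord0 == a)%:R * (K * c ^+ 2 / (4 * f1 ^+ 2))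
      + (lift ord0 k == a)%:R * (K * c ^+ 2 / (4 * f1 ^+ 2)))).
    by rewrite big_split/= !sum_delta_l; move: K K0 => K1 _; field.
  by move=> a _; rewrite d_l d_r curvature_lr !(eq_sym a); move: K K0 => K1 ?; field; rewrite f1n0.
have sum_rr k : \sum_j d (rshift n.+1 k) * d (rshift n.+1 j)
    * T (rshift n.+1 k) (rshift n.+1 j) = K^-1 * (n%:R - 1).
  rewrite (eq_bigr (fun j => K^-1 + (k == j)%:R * - K^-1)).
    by rewrite big_split/= sum_delta_l sum_cst; ring.
  by move=> j _; rewrite !d_r curvature_rr; move: K K0 => K1 ?; field.
under eq_bigr do rewrite big_split_ord/= sum_ll.
rewrite !big_split/= sum_delta_l sum_cst exchange_big/=.
have -> : \sum_k \sum_a d (lshift n a) * d (rshift n.+1 k) * T (lshift n a) (rshift n.+1 k)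
    = n%:R * (K * c ^+ 2 / (2 * f1 ^+ 2)).
  by rewrite -sum_cst; apply: eq_bigr => k _; rewrite sum_lr.
have -> : \sum_k \sum_i d (rshift n.+1 k) * d i * T (rshift n.+1 k) i
    = n%:R * (K * c ^+ 2 / (2 * f1 ^+ 2) + K^-1 * (n%:R - 1)).
  rewrite -sum_cst; apply: eq_bigr => k _; rewrite big_split_ord/= sum_rr -(sum_lr k).
  by congr (_ + _); apply: eq_bigr => a _; rewrite curvature_rl [X in X * _]mulrC.
by rewrite -natr1; move: K K0 => K1 K10; field; rewrite f1n0.
Qed.

End BundleMetricJet.

(** * The sphere bundles of a space form *)

Section SpaceFormChart.
Context {R : realType} {n : nat} (e : geometry) (r : R) (A : 'M[R]_n.+1).
Hypothesis r0 : 0 < r.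
Local Notation Q := (ambient_form R n e).
Local Notation eps := (geom_sign R e).
Local Notation c := (eps / r ^+ 2).
Local Notation rho := (conformal_factor c).
Local Notation psi := (space_form_chart e r A).
Hypothesis AQ : A *m Q *m A^T = Q.

(** The second condition keeps the image of the chart on the upper sheet of the
    hyperboloid, whether or not A preserves that sheet. *)
Definition chart_domain : set 'rV[R]_n :=
  [set x | 0 < rho x /\ (e = Hyperbolic -> 0 < psi x 0 ord0)].

Lemma chart_domain_rho x : chart_domain x -> 0 < rho x. Proof. by case. Qed.

Lemma open_chart_domain : open chart_domain.
Proof.
pose V := [set x : 'rV[R]_n | setT x /\ 0 < rho x].
have oV : open V := open_positive openT (smooth_conformal_factor c setT).
have [eS|eH] : e = Spherical \/ e = Hyperbolic by case: (e); [left|right].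
  suff -> : chart_domain = V by [].
  by apply/seteqP; split=> x; [case|case=> _ rx; split=> //; rewrite eS].
have -> : chart_domain = [set x | V x /\ 0 < psi x 0 ord0].
  by apply/seteqP; split=> x [Vx px]; split=> //; [exact: px|case: Vx].
apply: (open_positive oV).
have VrhoP x : V x -> 0 < rho x by case.
exact: (smooth_space_form_chart A VrhoP ord0).
Qed.

Let oU := open_chart_domain.
Let Urho := chart_domain_rho.

Lemma space_form_parametrization :
  local_parametrization chart_domain psi (space_form e r).
Proof.
have Au := isometry_unitmx AQ.
have sp j := smooth_space_form_chart A Urho j.
split=> //.
- exact: smooth_fun_smooth_on.
- move=> x y; rewrite !inE => /Urho rx /Urho ry xy.
  apply: (@stereographic_inj _ _ e r r0); rewrite ?inE//.
  have := congr1 (fun M => M *m invmx A) xy.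
  by rewrite /space_form_chart /= !mulmxK.
- move=> _ [x [rx px] <-]; split=> //.
  by rewrite inner_isometry// stereographic_norm.
- move=> x Ux; apply/row_freeP.
  exists (Q *m ('J psi x)^T *m (rho x ^+ 2)%:M).
  rewrite !mulmxA -[X in X *m _]/(pullback psi (fun=> Q) x).
  rewrite (pullback_space_form_chart r0 oU Urho AQ Ux) -scalar_mxM mulVf//.
  by rewrite expf_neq0// gt_eqF// Urho.
Qed.

Lemma conformal_factor0 : rho (0 : 'rV[R]_n) = 1.
Proof.
by rewrite /conformal_factor big1 ?mulr0 ?addr0// => k _; rewrite mxE mulr0.
Qed.

Lemma stereographic_origin : stereographic e r (0 : 'rV[R]_n) = r *: 'e_ord0.
Proof.
apply/rowP => j; case: (unliftP ord0 j) => [k ->|->].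
  by rewrite stereographicS !mxE mul0r mulr0.
by rewrite stereographic0 conformal_factor0 !mxE !eqxx /=; field.
Qed.

Lemma space_form_chart0 : psi 0 = r *: 'e_ord0 *m A.
Proof. by rewrite /space_form_chart stereographic_origin. Qed.

Lemma jacobian_space_form_chart0 a : chart_domain 0 ->
  'e_a *m 'J psi 0 = 'e_(lift ord0 a) *m A :> 'rV[R]_n.+1.
Proof.
move=> U0; rewrite (jacobian_space_form_chart A oU Urho U0) mulmxA; congr (_ *m A).
rewrite -rowE; apply/rowP => j.
rewrite [LHS]mxE (jacobianE _ _ oU (smooth_stereographic Urho) U0).
case: (unliftP ord0 j) => [k ->|->].
  rewrite (partial_stereographicS r0 oU Urho)// conformal_factor0 !mxE.
  by rewrite (inj_eq lift_inj) (eq_sym a) /= mulr0 !mul0r subr0 divr1.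
rewrite (partial_stereographic0 r0 oU Urho)//.
by rewrite !mxE mulr0 mul0r.
Qed.

End SpaceFormChart.

Lemma hemisphere_center (R : realType) n : hemisphere (0 : 'rV[R]_n) = 'e_ord0.
Proof.
apply/rowP => j; case: (unliftP ord0 j) => [k ->|->].
  by rewrite hemisphereS !mxE.
rewrite hemisphere0 big1 => [|k _]; last by rewrite mxE mul0r.
by rewrite subr0 sqrtr1 mxE eqxx.
Qed.

Definition sphere_bundle_scal (R : realType) n (c f1 f2 s : R) : R :=
  n%:R * (n.+1%:R * c / f1 + (n%:R - 1) / (f2 * s ^+ 2)
          - f2 * s ^+ 2 * c ^+ 2 / (2 * f1 ^+ 2)).

(** The coordinates are centred at z: there p and u become x = 0 and v = s e_0, the
    image of w = 0. *)
Lemma tangent_sphere_scalar_curvatureE (R : realType) n e (r f1 f2 s : R) z :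
  0 < r -> 0 < f1 -> 0 < f2 -> 0 < s -> tangent_sphere (m := n.+1) e r s z ->
  tangent_sphere_scalar_curvature e r f1 f2 s z
    (sphere_bundle_scal n (geom_sign R e / r ^+ 2) f1 f2 s).
Proof.
case: z => p u r0 f10 f20 s0 zS.
have [A AQ [Ap Au]] := adapted_frame r0 s0 zS.
pose c := geom_sign R e / r ^+ 2.
pose U := chart_domain e r A; pose psi := space_form_chart e r A.
have psi0 : psi 0 = p by rewrite /psi space_form_chart0.
have U0 : U 0.
  split; first by rewrite conformal_factor0.
  by move=> eH; rewrite -/psi psi0; case: zS => -[_ /(_ eH)].
have oU : open U by exact: open_chart_domain.
have Urho x : U x -> 0 < conformal_factor c x by exact: chart_domain_rho.
exists U, psi, 0, (s *: 'e_ord0); split=> //.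
- exact: space_form_parametrization.
- by rewrite -scalemxAl (jacobian_space_form_chart0 r0 ord0 U0) scalemxAl.
set g := pullback psi _.
have gE x : U x -> g x = (conformal_factor c x ^- 2)%:M.
  exact: pullback_space_form_chart.
have chrE i j k x : U x -> christoffel g i j k x = - (c / 2) / conformal_factor c x
    * ((i == k)%:R * x 0 j + (j == k)%:R * x 0 i - (i == j)%:R * x 0 k).
  exact: christoffel_space_form_chart.
exists (regular_bundle_domain c s f1 f2 U), (bundle_chart c s), 0.
have W0 := regular_bundle_domain0 oU Urho U0 s0 f10 f20.
split=> //.
- exact: bundle_parametrization.
- rewrite /bundle_chart !linear0 conformal_factor0 mulr1.
  by rewrite hemisphere_center.
have [oW _ _ _ _] := bundle_parametrization f1 f2 s0 oU Urho gE chrE.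
rewrite (scalar_curvature_eq_on oW (h := bundle_metric c s f1 f2) _ W0).
  exact: (bundle_scalar_curvature oU Urho U0 s0 f10 f20).
by move=> y [By _]; exact: (pullback_bundle_chart s f1 f2 oU Urho gE chrE By).
Qed.

(** For s < 1 everything is bounded but the multiple of s^-2, which is positive. *)
Lemma sphere_bundle_scal_pos_near0 (R : realType) n (c f1 f2 : R) : (1 < n)%N ->
  0 < f1 -> 0 < f2 -> exists s0 : R, 0 < s0 /\
    forall s, 0 < s -> s < s0 -> 0 < sphere_bundle_scal n c f1 f2 s.
Proof.
move=> n1 f10 f20.
pose k := n.+1%:R * c / f1; pose a := (n%:R - 1) / f2.
pose b := f2 * c ^+ 2 / (2 * f1 ^+ 2).
have nR : 1 < n%:R :> R by rewrite ltr1n.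
have a0 : 0 < a by rewrite divr_gt0// subr_gt0.
have b0 : 0 <= b by rewrite divr_ge0// mulr_ge0 ?sqr_ge0// ltW.
have D0 : 0 < `|k| + b + 1 by have := normr_ge0 k; lra.
exists (Num.min 1 (a / (`|k| + b + 1))); split; first by rewrite lt_min ltr01 divr_gt0.
move=> s s0; rewrite lt_min => /andP[s1 sa].
have sn0 : s != 0 by rewrite gt_eqF.
rewrite /sphere_bundle_scal mulr_gt0//; first by rewrite (lt_trans ltr01).
have -> : n.+1%:R * c / f1 + (n%:R - 1) / (f2 * s ^+ 2)
    - f2 * s ^+ 2 * c ^+ 2 / (2 * f1 ^+ 2) = k + a / s ^+ 2 - b * s ^+ 2.
  by rewrite /k /a /b; field; rewrite sn0 !gt_eqF.
have s2 : s ^+ 2 <= s by rewrite expr2 ler_piMr// ltW.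
have s20 : 0 < s ^+ 2 by rewrite exprn_gt0.
have as2 : `|k| + b + 1 < a / s ^+ 2.
  rewrite ltr_pdivlMr//; move: sa; rewrite ltr_pdivlMr// mulrC.
  by apply: le_lt_trans; rewrite ler_wpM2l// ltW.
have bs : b * s ^+ 2 <= b by rewrite ler_piMr// (le_trans s2)// ltW.
have := ler_norm (- k); rewrite normrN; lra.
Qed.

(** For s > 1 everything is bounded but the multiple of s^2, which is negative. *)
Lemma sphere_bundle_scal_neg_near_oo (R : realType) n (c f1 f2 : R) : (0 < n)%N ->
  c != 0 -> 0 < f1 -> 0 < f2 -> exists s1 : R, 0 < s1 /\
    forall s, s1 < s -> sphere_bundle_scal n c f1 f2 s < 0.
Proof.
move=> n1 c0 f10 f20.
pose k := n.+1%:R * c / f1; pose a := (n%:R - 1) / f2.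
pose b := f2 * c ^+ 2 / (2 * f1 ^+ 2).
have nR : 1 <= n%:R :> R by rewrite ler1n.
have a0 : 0 <= a by rewrite divr_ge0 ?subr_ge0// ltW.
have c2 : 0 < c ^+ 2 by rewrite exprn_even_gt0.
have b0 : 0 < b by rewrite divr_gt0// mulr_gt0// exprn_gt0.
have D0 : 0 < `|k| + a + 1 by have := normr_ge0 k; lra.
exists (Num.max 1 ((`|k| + a + 1) / b)); split; first by rewrite lt_max ltr01.
move=> s; rewrite gt_max => /andP[s1 sa].
have s0 : 0 < s by rewrite (lt_trans ltr01).
have sn0 : s != 0 by rewrite gt_eqF.
rewrite /sphere_bundle_scal pmulr_rlt0; last by rewrite (lt_le_trans ltr01).
have -> : n.+1%:R * c / f1 + (n%:R - 1) / (f2 * s ^+ 2)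
    - f2 * s ^+ 2 * c ^+ 2 / (2 * f1 ^+ 2) = k + a / s ^+ 2 - b * s ^+ 2.
  by rewrite /k /a /b; field; rewrite sn0 !gt_eqF.
have s2 : s <= s ^+ 2 by rewrite expr2 ler_peMr// ltW.
have s20 : 0 < s ^+ 2 by rewrite exprn_gt0.
have as2 : `|k| + a + 1 < b * s ^+ 2.
  move: sa; rewrite ltr_pdivrMr// mulrC => /lt_le_trans; apply.
  by rewrite ler_wpM2l// ltW.
have bs : a / s ^+ 2 <= a.
  by rewrite ler_pdivrMr// ler_peMr// (le_trans _ s2)// ltW.
have := ler_norm k; lra.
Qed.

Unset Implicit Arguments.

Theorem theorem2p3 (R : realType) (m : nat) (e : geometry) (r f1 f2 : R)
  (hm : (3 <= m)%N) (hr : 0 < r) (hf1 : 0 < f1) (hf2 : 0 < f2) :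
  (exists s0 : R, 0 < s0 /\
     forall s : R, 0 < s -> s < s0 -> @positive_scalar_curvature R m e r f1 f2 s)
  /\
  (exists s1 : R, 0 < s1 /\
     forall s : R, s1 < s -> @negative_scalar_curvature R m e r f1 f2 s).
Proof.
case: m hm => // n n2; set c := geom_sign R e / r ^+ 2.
have c0 : c != 0.
  rewrite mulf_neq0 ?invr_neq0 ?expf_neq0 ?(gt_eqF hr)// /geom_sign.
  by case: (e); rewrite ?oppr_eq0 oner_eq0.
split.
- have [s0 [s00 pos]] := @sphere_bundle_scal_pos_near0 R n c f1 f2 n2 hf1 hf2.
  exists s0; split=> // s s_gt0 ss0 z zS; exists (sphere_bundle_scal n c f1 f2 s).
    exact: tangent_sphere_scalar_curvatureE.
  exact: pos.
- have [s1 [s10 neg]] := @sphere_bundle_scal_neg_near_oo R n c f1 f2 (ltnW n2) c0 hf1 hf2.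
  exists s1; split=> // s s1s z zS; exists (sphere_bundle_scal n c f1 f2 s).
    by apply: tangent_sphere_scalar_curvatureE => //; exact: lt_trans s1s.
  exact: neg.
Qed.
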